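(* Let $(X,T)$ be a saturated topological dynamical system, let $r\ge1$, let $\mathbb{B}$ be a real Banach space, let $\Phi:X^r\to\mathbb{B}^*$ be continuous (with $\mathbb{B}^*$ carrying the weak-star topology $\sigma(\mathbb{B}^*,\mathbb{B})$), let $\alpha\in\mathbb{B}^*$ and $W\subset\mathbb{B}$. Define $$E_\Phi(\alpha,W)=\Big\{x\in X:\ \limsup_{n\to\infty}\langle V_\Phi(n,x),w\rangle\le\langle\alpha,w\rangle\ \text{for all } w\in W\Big\},$$ where $V_\Phi(n,x)=n^{-r}\sum_{1\le i_1,\dots,i_r\le n}\Phi(T^{i_1}x,\dots,T^{i_r}x)$, and $$\mathcal{M}_\Phi(\alpha,W)=\Big\{\mu\in\mathcal{M}_{\rm inv}:\ \int_{X^r}\langle\Phi,w\rangle\,d\mu^{\otimes r}\le\langle\alpha,w\rangle\ \text{for all } w\in W\Big\}.$$ If $\mathcal{M}_\Phi(\alpha,W)=\emptyset$, then $E_\Phi(\alpha,W)=\emptyset$. If $\mathcal{M}_\Phi(\alpha,W)\neq\emptyset$, then $$h_{\rm top}(E_\Phi(\alpha,W))=\sup_{\mu\in\mathcal{M}_\Phi(\alpha,W)}h_\mu.$$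
   Context: $X$ is a compact metric space with metric $d$, $T:X\to X$ is continuous, $X^r$ is the $r$-fold product, $\mu^{\otimes r}$ the $r$-fold product measure. $\langle y,x\rangle$ denotes the duality pairing for $y\in\mathbb{B}^*$, $x\in\mathbb{B}$. $\mathcal{M}_{\rm inv}$ is the set of $T$-invariant Borel probability measures on $X$ and $h_\mu$ the measure-theoretic entropy. Topological entropy of a set (Bowen): with $d_n(x,y)=\max_{0\le j<n}d(T^jx,T^jy)$ and $B_n(x,\epsilon)$ the open $d_n$-ball, for $Z\subset X$ let $H^s_n(Z,\epsilon)=\inf\sum_ie^{-sn_i}$ over countable covers $\{B_{n_i}(x_i,\epsilon)\}$ of $Z$ with $\min_in_i\ge n$, $H^s(Z,\epsilon)=\lim_nH^s_n(Z,\epsilon)$, $h_{\rm top}(Z,\epsilon)$ the critical $s$ where $H^s(Z,\epsilon)$ jumps from $+\infty$ to $0$, and $h_{\rm top}(Z)=\lim_{\epsilon\to0}h_{\rm top}(Z,\epsilon)$. $G_\mu=\{x:\frac1n\sum_{j=0}^{n-1}\delta_{T^jx}\to\mu$ weak-star$\}$; $(X,T)$ is saturated if $h_{\rm top}(G_\mu)=h_\mu$ for all $\mu\in\mathcal{M}_{\rm inv}$. *)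

(* Defs.v *)
From HB Require Import structures.
From mathcomp Require Import all_boot all_order all_algebra.
From mathcomp Require Import all_classical all_reals all_analysis.
Set Implicit Arguments. Unset Strict Implicit. Unset Printing Implicit Defensive.
Import Order.TTheory GRing.Theory Num.Theory.
Import numFieldNormedType.Exports.
Local Open Scope classical_set_scope.
Local Open Scope ring_scope.

Notation borel X := (g_sigma_algebraType (@open X)).

(* Nonempty (pointed) metric spaces; measurable types of MathComp-Analysis are pointed. *)
#[short(type="pmetricType")]
HB.structure Definition PointedMetric (K : numDomainType) :=
  { M of Metric K M & Pointed M }.

Section Dynamics.
Context {R : realType} (X : pmetricType R) (T : X -> X).

Definition bowen_ball (n : nat) (x : X) (eps : R) : set X :=
  [set y | forall j : nat, (j < n)%N -> mdist (iter j T x) (iter j T y) < eps].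

(* A countable (possibly finite) family of Bowen balls B_{n_i}(x_i,eps) is encoded
   by c : nat -> option (X * nat); [None] = no ball at that index. *)
Definition bowen_cover (Z : set X) (eps : R) (N : nat)
    (c : nat -> option (X * nat)) : Prop :=
  (forall i x m, c i = Some (x, m) -> (N <= m)%N) /\
  Z `<=` [set y | exists i x m, c i = Some (x, m) /\ bowen_ball m x eps y].

Definition cover_weight (s : R) (c : nat -> option (X * nat)) : \bar R :=
  (\sum_(0 <= i <oo) (if c i is Some (x, m) then (expR (- s * m%:R))%:E else 0%E))%E.

Definition bowen_HN (s : R) (Z : set X) (eps : R) (N : nat) : \bar R :=
  ereal_inf [set cover_weight s c | c in bowen_cover Z eps N].

Definition bowen_H (s : R) (Z : set X) (eps : R) : \bar R :=
  limn (bowen_HN s Z eps).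

(* h_top(Z,eps): the critical value of s where H^s(Z,eps) jumps from +oo to 0 *)
Definition htop_eps (Z : set X) (eps : R) : \bar R :=
  ereal_inf [set s%:E | s in [set s : R | bowen_H s Z eps = 0%E]].

Definition htop (Z : set X) : \bar R :=
  lim (htop_eps Z eps @[eps --> 0^'+]).

Definition invariant (mu : probability (borel X) R) : Prop :=
  forall A : set (borel X), measurable A -> mu (T @^-1` A) = mu A.

Definition is_partition (k : nat) (P : 'I_k -> set (borel X)) : Prop :=
  (forall i, measurable (P i)) /\
  (forall i j, i != j -> P i `&` P j = set0) /\
  (forall x : X, exists i, P i x).

Definition join_atom (k n : nat) (P : 'I_k -> set (borel X)) (f : 'I_n -> 'I_k)
  : set (borel X) := [set x | forall j : 'I_n, P (f j) (iter j T x)].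

Definition join_entropy (mu : probability (borel X) R) (k : nat)
    (P : 'I_k -> set (borel X)) (n : nat) : R :=
  \sum_(f : {ffun 'I_n -> 'I_k})
     - (fine (mu (join_atom P f)) * ln (fine (mu (join_atom P f)))).

Definition part_entropy (mu : probability (borel X) R) (k : nat)
    (P : 'I_k -> set (borel X)) : R :=
  limn (fun n => n%:R^-1 * join_entropy mu P n).

Definition mentropy (mu : probability (borel X) R) : \bar R :=
  ereal_sup [set e | exists (k : nat) (P : 'I_k -> set (borel X)),
                       is_partition P /\ e = (part_entropy mu P)%:E].

Definition generic_points (mu : probability (borel X) R) : set X :=
  [set x | forall f : X -> R, continuous f ->
     (fun n : nat => n%:R^-1 * \sum_(j < n) f (iter j T x)) @ \oo
       --> Rintegral mu setT f].

Definition saturated : Prop :=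
  forall mu : probability (borel X) R, invariant mu ->
    htop (generic_points mu) = mentropy mu.

Definition ocons (r : nat) (x : X) (y : 'I_r -> X) : 'I_r.+1 -> X :=
  fun i => if unlift ord0 i is Some j then y j else x.

Fixpoint prod_integral (mu : probability (borel X) R) (r : nat)
  : (('I_r -> X) -> R) -> R :=
  match r return (('I_r -> X) -> R) -> R with
  | 0 => fun g => g (fun _ => point)
  | r'.+1 => fun g =>
      Rintegral mu setT (fun x : borel X => prod_integral mu (fun y => g (ocons x y)))
  end.

End Dynamics.
Arguments prod_integral {R X} mu r g.

Section Banach.
Context {R : realType} (B : completeNormedModType R).

Definition is_dual (f : B -> R) : Prop :=
  (forall (a : R) (u v : B), f (a *: u + v) = a * f u + f v) /\ continuous f.

End Banach.

Section Sets.
Context {R : realType} (X : pmetricType R) (T : X -> X)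
  (B : completeNormedModType R) (r : nat) (Phi : {ptws 'I_r -> X} -> B -> R).

Definition V_pair (n : nat) (x : X) (w : B) : R :=
  (n%:R ^+ r)^-1 * \sum_(i : {ffun 'I_r -> 'I_n}) Phi (fun k => iter (i k).+1 T x) w.

Definition E_Phi (alpha : B -> R) (W : set B) : set X :=
  [set x | forall w, W w -> (limn_esup (fun n => (V_pair n x w)%:E) <= (alpha w)%:E)%E].

Definition M_Phi (alpha : B -> R) (W : set B) : set (probability (borel X) R) :=
  [set mu | invariant T mu /\
            forall w, W w -> prod_integral mu r (fun x : 'I_r -> X => Phi x w) <= alpha w].
End Sets.

(* Main.v *)
(* Lower bound: if [x] is [mu]-generic, the [r]-fold means of a continuous
   function along the orbit of [x] converge to its [mu^r]-integral, so the
   generic points of every [mu] in [M_Phi] lie in [E_Phi], and saturation gives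
   the entropy of this set.
   Upper bound: for [x] in [E_Phi], the limits of the empirical means along an
   ultrafilter finer than [\oo] form a [T]-invariant positive functional on
   continuous functions, hence (Riesz) an invariant probability [mu], which lies
   in [M_Phi]. It remains to prove Bowen's bound: a set of points each having
   some limit measure of entropy less than [s] has [H^s = 0]. Take a partition
   into small pieces with [mu]-null boundaries. Since the conditional block
   entropies decrease to the entropy, some conditional entropy is less than [s],
   and approximating the conditional probabilities by weights [exp (- b / M)]
   with [b] natural gives countably many choices. Along infinitely many [n], the
   code of [x] then has total weight at least [exp (- n (s - 2 / M))], whereas the
   weights of all words of length [n] sum to at most [C exp (n / M)]; this counts
   the codes, and each code is covered by one Bowen ball. *)

Require Import Defs.
From HB Require Import structures.
From mathcomp Require Import all_boot all_order all_algebra.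
From mathcomp Require Import all_classical all_reals all_analysis.
From mathcomp Require Import lra ring zify.
Import Order.TTheory GRing.Theory Num.Theory.
Import numFieldNormedType.Exports.
Set Implicit Arguments. Unset Strict Implicit. Unset Printing Implicit Defensive.
Local Open Scope classical_set_scope.
Local Open Scope ring_scope.

(** * Words, block entropy and weights *)

Section Words.
Variable A : finType.

Fixpoint words (n : nat) : seq (seq A) :=
  if n is n'.+1 then [seq a :: w | a <- enum A, w <- words n'] else [:: [::]].

Lemma big_words0 (V : nmodType) (F : seq A -> V) :
  \sum_(w <- words 0) F w = F [::].
Proof. by rewrite big_seq1. Qed.

Lemma big_words_cons (V : nmodType) n (F : seq A -> V) :
  \sum_(w <- words n.+1) F w = \sum_(w <- words n) \sum_a F (a :: w).
Proof.
rewrite exchange_big/= big_flatten/= big_map big_enum/=.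
by apply: eq_bigr => a _; rewrite big_map.
Qed.

Lemma big_words_rcons (V : nmodType) n (F : seq A -> V) :
  \sum_(w <- words n.+1) F w = \sum_(w <- words n) \sum_a F (rcons w a).
Proof.
elim: n F => [|n IHn] F; first by rewrite big_words_cons !big_words0.
rewrite big_words_cons exchange_big/=.
under eq_bigr do rewrite IHn.
by rewrite -exchange_big/= [RHS]big_words_cons.
Qed.

Lemma mem_words n w : (w \in words n) = (size w == n).
Proof.
elim: n w => [|n IHn] w; first by rewrite inE size_eq0.
apply/allpairsP/idP => [[[a v]/= [_ + ->]]|].
  by rewrite IHn.
by case: w => // a v; exists (a, v); rewrite /= mem_enum IHn; split.
Qed.

Lemma uniq_words n : uniq (words n).
Proof.
elim: n => [//|n IHn] /=; apply: allpairs_uniq; rewrite ?enum_uniq//.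
by move=> [a v] [b w] _ _ /= [-> ->].
Qed.

Lemma big_ffun_words (V : nmodType) n (F : seq A -> V) :
  \sum_(f : {ffun 'I_n -> A}) F (codom f) = \sum_(w <- words n) F w.
Proof.
rewrite -(big_map (fun f : {ffun 'I_n -> A} => codom f) predT F).
apply: perm_big; apply: uniq_perm; rewrite ?uniq_words//.
  rewrite map_inj_in_uniq ?index_enum_uniq//.
  by move=> f g _ _ fg; apply: (can_inj fgraphK); apply: val_inj.
move=> w; rewrite mem_words; apply/mapP/eqP => [[f _ ->]|wn].
  by rewrite size_codom card_ord.
have wc : size w == #|'I_n| by rewrite card_ord wn.
by exists (Finfun (Tuple wc)); rewrite ?mem_index_enum// codom_ffun FinfunK.
Qed.

Lemma size_words n : size (words n) = (#|A| ^ n)%N.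
Proof.
by elim: n => [//|n IHn] /=; rewrite size_allpairs -cardE IHn expnS.
Qed.

End Words.
Arguments words A n : clear implicits.

(* [p w] is the measure of the cylinder of the word [w] for a shift-invariant
   process with finite alphabet [A]. *)
Section Process.
Context {R : realType} (A : finType) (p : seq A -> R).
Hypotheses (p_ge0 : forall w, 0 <= p w) (p_nil : p [::] = 1).
Hypotheses (p_cons : forall w, \sum_a p (a :: w) = p w).
Hypotheses (p_rcons : forall w, \sum_a p (rcons w a) = p w).

Definition word_entropy n := \sum_(w <- words A n) - (p w * ln (p w)).

(** This is the conditional entropy of a letter given the [n] letters that follow it. *)
Definition cond_entropy n :=
  \sum_(w <- words A n) \sum_a p (a :: w) * (ln (p w) - ln (p (a :: w))).

Lemma word_entropyS n : word_entropy n.+1 = word_entropy n + cond_entropy n.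
Proof.
rewrite /word_entropy /cond_entropy big_words_cons -big_split/=.
apply: eq_bigr => w _.
rewrite -{1}(p_cons w) mulr_suml -sumrN -big_split/=.
by apply: eq_bigr => a _; ring.
Qed.

Lemma p_cons_le a w : p (a :: w) <= p w.
Proof. by rewrite -[leRHS]p_cons (bigD1 a)//= lerDl sumr_ge0. Qed.

Lemma p_rcons_le w a : p (rcons w a) <= p w.
Proof. by rewrite -[leRHS]p_rcons (bigD1 a)//= lerDl sumr_ge0. Qed.

Lemma p_le1 w : p w <= 1.
Proof.
by elim: w => [|a w IHw]; rewrite ?p_nil// (le_trans (p_cons_le _ _)).
Qed.

Lemma word_entropy_ge0 n : 0 <= word_entropy n.
Proof.
apply: sumr_ge0 => w _; rewrite oppr_ge0 mulr_ge0_le0//.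
exact/ln_le0/p_le1.
Qed.

Lemma sum_words_p n : \sum_(w <- words A n) p w = 1.
Proof.
elim: n => [|n IHn]; first by rewrite big_words0.
by rewrite big_words_cons -IHn; apply: eq_bigr => w _; rewrite p_cons.
Qed.

(* Termwise, [ln y <= y - 1] with
   [y = p (w b) p (a w) / (p (a w b) p w)]. *)
Lemma cond_entropyS_le n : cond_entropy n.+1 <= cond_entropy n.
Proof.
have term w a b : p (a :: rcons w b) * (ln (p (rcons w b)) - ln (p (a :: rcons w b)))
    <= p (a :: rcons w b) * (ln (p w) - ln (p (a :: w))) +
       (p (rcons w b) * p (a :: w) / p w - p (a :: rcons w b)).
  have := p_ge0 (a :: rcons w b); rewrite le_eqVlt => /predU1P[<-|p0].
    by rewrite !mul0r add0r subr0 divr_ge0 ?mulr_ge0.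
  have pwb : 0 < p (rcons w b) by rewrite (lt_le_trans p0)// p_cons_le.
  have paw : 0 < p (a :: w) by rewrite (lt_le_trans p0)// -rcons_cons p_rcons_le.
  have pw : 0 < p w by rewrite (lt_le_trans paw)// p_cons_le.
  set x := p _ in p0 *; set y := p _ in pwb *; set z := p (a :: w) in paw *.
  set v := p w in pw *.
  have : ln (y * z / v / x) <= y * z / v / x - 1.
    have t0 : 0 < y * z / v / x by rewrite !divr_gt0// mulr_gt0.
    by have := @le_ln1Dx _ (y * z / v / x - 1); rewrite [1 + _]addrC subrK; apply; lra.
  rewrite !ln_div ?posrE ?divr_gt0 ?mulr_gt0// lnM ?posrE// => h.
  have := ler_wpM2l (ltW p0) h.
  have -> : x * (y * z / v / x - 1) = y * z / v - x by field; rewrite !gt_eqF.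
  lra.
have -> : cond_entropy n.+1 = \sum_(w <- words A n) \sum_b \sum_a
    p (a :: rcons w b) * (ln (p (rcons w b)) - ln (p (a :: rcons w b))).
  by rewrite /cond_entropy big_words_rcons.
have -> : cond_entropy n = \sum_(w <- words A n) \sum_b \sum_a
   (p (a :: rcons w b) * (ln (p w) - ln (p (a :: w))) +
       (p (rcons w b) * p (a :: w) / p w - p (a :: rcons w b))).
  rewrite /cond_entropy; apply: eq_bigr => w _.
  under [RHS]eq_bigr do rewrite big_split/=.
  rewrite big_split/=.
  have -> : \sum_b \sum_a
      (p (rcons w b) * p (a :: w) / p w - p (a :: rcons w b)) = 0.
    under eq_bigr do rewrite sumrB p_cons -mulr_suml -mulr_sumr p_cons.
    have [p0|p0] := eqVneq (p w) 0.
      under eq_bigr do rewrite p0 invr0 mulr0 sub0r.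
      by rewrite sumrN p_rcons p0 oppr0.
    by apply: big1 => b _; rewrite mulfK ?subrr.
  rewrite addr0 exchange_big/=; apply: eq_bigr => a _.
  by rewrite -mulr_suml; under eq_bigr do rewrite -rcons_cons; rewrite p_rcons.
apply: ler_sum => w _; apply: ler_sum => b _; apply: ler_sum => a _.
exact: term.
Qed.

(** Block entropy is a sum of [n] increments ([word_entropyS]), and by monotonicity [cond_entropy n]
    is at most each of them. *)
Lemma le_mul_cond_entropy n : n%:R * cond_entropy n <= word_entropy n.
Proof.
elim: n => [|n IHn]; first by rewrite mul0r word_entropy_ge0.
have := cond_entropyS_le n; rewrite word_entropyS -natr1 => h.
have : n.+1%:R * cond_entropy n.+1 <= n.+1%:R * cond_entropy n by rewrite ler_wpM2l.
rewrite -natr1; lra.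
Qed.

(** If every conditional entropy were at least [s], block entropies would be at least [n * s], and
    so would be the limit of their averages. Most of the work shows that this limit exists, the
    averages being nonincreasing. *)
Lemma cond_entropy_lt (s : R) :
  limn (fun n => n%:R^-1 * word_entropy n) < s -> exists j, cond_entropy j < s.
Proof.
set u := fun n => _; move=> us; apply/not_existsP => ds.
have {}ds j : s <= cond_entropy j by rewrite leNgt; apply/negP/ds.
(* The index starts at 1, since [u 0] is 0 by the convention [0^-1 = 0]. *)
have us1 : nonincreasing_seq (fun n => u n.+1).
  apply/nonincreasing_seqP => n; rewrite /u.
  rewrite ler_pdivrMl ?ltr0n// mulrCA ler_pdivlMl ?ltr0n//.
  rewrite [word_entropy n.+2]word_entropyS.
  have := le_mul_cond_entropy n.+1.
  rewrite -[n.+2%:R]natr1; lra.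
have cu1 : cvgn (fun n => u n.+1).
  apply: nonincreasing_is_cvgn => //; exists 0 => _ [n _ <-].
  by rewrite /u mulr_ge0 ?invr_ge0 ?word_entropy_ge0.
have cu : cvgn u by have [l] := (cvg_ex _).1 cu1; rewrite cvg_shiftS => /cvgP.
have Hs n : n%:R * s <= word_entropy n.
  elim: n => [|n IHn]; first by rewrite mul0r word_entropy_ge0.
  by rewrite word_entropyS -natr1 mulrDl mul1r lerD.
have : s <= limn u.
  apply: limr_ge => //; near=> n.
  by rewrite /u ler_pdivlMl ?ltr0n//; near: n; exists 1.
lra.
Unshelve. all: by end_near. Qed.

End Process.

(** * Exponential weights of words *)

Section Weights.
Context {R : realType} (A : finType).

(* Each letter is weighted given the [j] letters that follow it, and the last [j]
   letters of a word do not count. *)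
Fixpoint word_weight (j : nat) (a : seq A -> A -> R) (w : seq A) : R :=
  if w is c :: w' then
    (if (j <= size w')%N then expR (- a (take j w') c) else 1) * word_weight j a w'
  else 1.

Lemma word_weight_ge0 j a w : 0 <= word_weight j a w.
Proof. by elim: w => //= c w IHw; rewrite mulr_ge0//; case: ifP => // _; rewrite expR_ge0. Qed.

Lemma word_weight_short j a w : (size w <= j)%N -> word_weight j a w = 1.
Proof.
elim: w => //= c w IHw wj.
by rewrite leqNgt wj/= mul1r IHw// ltnW.
Qed.

Lemma word_weight_code (c : nat -> A) j a n :
  word_weight j a (mkseq c (n + j)) =
  expR (- \sum_(i < n) a (mkseq (fun t => c (i.+1 + t)%N) j) (c i)).
Proof.
elim: n c => [|n IHn] c.
  by rewrite big_ord0 oppr0 expR0 word_weight_short// size_mkseq.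
have -> : mkseq c (n.+1 + j) = c 0%N :: mkseq (fun t => c t.+1) (n + j).
  by rewrite /mkseq addSn/= -[1%N]/(1 + 0)%N iotaDl -map_comp.
have tk : take j (mkseq (fun t => c t.+1) (n + j)) = mkseq (fun t => c t.+1) j.
  by rewrite /mkseq -map_take take_iota (minn_idPl (leq_addl _ _)).
by rewrite big_ord_recl opprD expRD /= size_mkseq leq_addl tk IHn.
Qed.

(** Summing over the first letter costs a factor of at most [e], because its weight depends only on
    the next [j] letters; the last [j] letters are unweighted and contribute their number
    [#|A| ^ j]. *)
Lemma sum_word_weight j a (e : R) n :
  0 <= e -> (forall u, size u = j -> \sum_c expR (- a u c) <= e) ->
  \sum_(w <- words A (n + j)) word_weight j a w <= (#|A| ^ j)%:R * e ^+ n.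
Proof.
move=> e0 ae; elim: n => [|n IHn].
  rewrite add0n expr0 mulr1 -size_words -sum1_size natr_sum big_seq [leRHS]big_seq.
  by apply: ler_sum => w; rewrite mem_words => /eqP wj; rewrite word_weight_short ?wj.
rewrite addSn big_words_cons exprSr mulrA.
apply: (@le_trans _ _ (\sum_(w <- words A (n + j)) word_weight j a w * e)).
  rewrite big_seq [leRHS]big_seq; apply: ler_sum => w; rewrite mem_words => /eqP wnj /=.
  rewrite wnj leq_addl -mulr_suml mulrC ler_wpM2l ?word_weight_ge0// ae//.
  by rewrite size_take wnj; case: ltngtP (leq_addl n j).
by rewrite -mulr_suml ler_wpM2r.
Qed.

(* [theta] lists numerators in the order of [words A j.+1], so that there are only
   countably many weights. *)
Definition code_weight (M j : nat) (theta : seq nat) (w : seq A) (c : A) : R :=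
  (nth 0 theta (index (c :: w) (words A j.+1)))%:R / M.+1%:R.

(** The ideal weight of a letter [c] before [u] is [- ln (p (c :: u) / p u)]: for [p u] positive the
    exponentials sum to 1, and the mean weight is the conditional entropy. Rounding up to multiples
    of [1 / M.+1] costs at most [1 / M.+1] in the mean, and letters of probability zero get a large
    finite weight. *)
Lemma exists_code_weight (p : seq A -> R) (j : nat) (s : R) :
  (forall w, 0 <= p w) -> (forall w, \sum_a p (a :: w) = p w) -> p [::] = 1 ->
  cond_entropy p j < s ->
  exists M theta,
    (forall u, size u = j -> \sum_c expR (- code_weight M j theta u c) <= expR (M.+1%:R^-1)) /\
    \sum_(w <- words A j) \sum_a p (a :: w) * code_weight M j theta w a
      < s - 2 / M.+1%:R.
Proof.
move=> p_ge0 p_cons p_nil ds.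
have p_le w a : p (a :: w) <= p w.
  by rewrite -[leRHS]p_cons (bigD1 a)//= lerDl sumr_ge0.
have sp : 0 < s - cond_entropy p j by rewrite subr_gt0.
(* The final estimate needs [3 / m < s - cond_entropy p j]: one [1 / m] for the rounding and two for
   the margin in the statement. *)
have [M] : exists M, 4 < M.+1%:R * (s - cond_entropy p j).
  exists (Num.truncn (4 / (s - cond_entropy p j))).
  by rewrite -ltr_pdivrMr// truncnS_gt.
set m : R := M.+1%:R => Mm.
have m0 : 0 < m by rewrite ltr0n.
(* Slack per letter; over the whole alphabet it adds up to [expR m^-1 - 1]. *)
pose eta := (expR m^-1 - 1) / #|A|%:R.
have Hb (w : seq A) : exists b : nat, if w is a :: u then
    expR (- (b%:R / m)) <= p w / p u + eta /\
    p w * (b%:R / m) <= p w * (ln (p u) - ln (p w) + m^-1) else True.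
  case: w => [|a u]; first by exists 0.
  have A0 : (0 < #|A|)%N by apply/card_gt0P; exists a.
  have eta0 : 0 < eta by rewrite divr_gt0 ?ltr0n// subr_gt0 expR_gt1 invr_gt0.
  have := p_ge0 (a :: u); rewrite le_eqVlt => /predU1P[p0|p0].
    (* A letter of probability zero: [b] is so large that [expR (- (b / m))] is below the slack. *)
    exists (Num.truncn (- ln eta * m)).+1; rewrite -p0 !mul0r add0r; split => //.
    rewrite -[leRHS]lnK ?posrE// ler_expR lerNl ler_pdivlMr//.
    by rewrite ltW// truncnS_gt.
  have pu : 0 < p u by rewrite (lt_le_trans p0).
  pose z := (ln (p u) - ln (p (a :: u))) * m.
  have z0 : 0 <= z by rewrite mulr_ge0 ?subr_ge0 ?ler_ln ?posrE// ltW.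
  (* Rounding [z] up keeps the exponential below the conditional probability and raises the weight
     by at most [m^-1]. *)
  exists (Num.truncn z).+1; split.
    apply: (@le_trans _ _ (p (a :: u) / p u)); last by rewrite lerDl ltW.
    rewrite -[leRHS]lnK ?posrE ?divr_gt0// ler_expR ln_div ?posrE//.
    rewrite lerNl opprB ler_pdivlMr// -/z.
    by rewrite ltW// truncnS_gt.
  rewrite ler_wpM2l ?(ltW p0)// ler_pdivrMr// mulrDl mulVf ?gt_eqF// -/z.
  by rewrite -natr1 lerD2r truncn_le.
have [b {}Hb] := choice Hb.
exists M, (map b (words A j.+1)).
have codeE u c : size u = j ->
    code_weight M j [seq b i | i <- words A j.+1] u c = (b (c :: u))%:R / m.
  move=> uj; have cu : c :: u \in words A j.+1 by rewrite mem_words /= uj.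
  by rewrite /code_weight (nth_map [::]) ?index_mem// nth_index.
split.
  move=> u uj; apply: (@le_trans _ _ (\sum_c (p (c :: u) / p u + eta))).
    by apply: ler_sum => c _; rewrite codeE//; case: (Hb (c :: u)).
  rewrite big_split/= sumr_const -mulr_suml p_cons -/m.
  have -> : expR m^-1 = 1 + (expR m^-1 - 1) by rewrite addrC subrK.
  apply: lerD.
    have [->|pu] := eqVneq (p u) 0; first by rewrite mul0r.
    by rewrite divff.
  rewrite -mulr_natr /eta; have [->|A0] := eqVneq #|A| 0%N.
    by rewrite mulr0 subr_ge0 -expR0 ler_expR invr_ge0 ltW.
  by rewrite divfK// pnatr_eq0.
apply: (@le_lt_trans _ _ (cond_entropy p j + m^-1)).
  apply: (@le_trans _ _ (\sum_(w <- words A j) \sum_a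
     (p (a :: w) * (ln (p w) - ln (p (a :: w))) + p (a :: w) * m^-1))).
    rewrite big_seq [leRHS]big_seq; apply: ler_sum => w; rewrite mem_words => /eqP wj.
    apply: ler_sum => c _; rewrite codeE// -mulrDr.
    by case: (Hb (c :: w)).
  under eq_bigr do rewrite big_split/= -mulr_suml p_cons.
  rewrite big_split/=; have -> : \sum_(w <- words A j) p w * m^-1 = m^-1 by rewrite -mulr_suml sum_words_p// mul1r.
 by [].
rewrite -/m ltrBrDr -addrA -ltrBrDl -{1}[m^-1]mul1r -mulrDl ltr_pdivrMr// mulrC.
by apply: lt_trans Mm; lra.
Qed.

End Weights.

(** * Bowen covers *)

Section DoubleSeries.
Local Open Scope ereal_scope.
Context {R : realType}.

(** The enumeration of pairs is chosen before the series, so that a single one can serve the values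
    [f x] and [L f] at the same time. *)
Lemma nneseries_pairing : exists e : nat -> nat * nat,
  (forall p, exists k, e k = p) /\
  forall a : nat -> nat -> \bar R, (forall i j, 0 <= a i j) ->
  \sum_(k <oo) a (e k).1 (e k).2 = \sum_(i <oo) \sum_(j <oo) a i j.
Proof.
have /card_esym/ppcard_eqP[f] := card_nat2.
exists f; split => [p|a a0].
  by exists (f^-1%FUN p); rewrite invK ?inE.
rewrite nneseries_esumT//.
rewrite -(@reindex_esum R _ _ [set: nat] [set: nat * nat] f (fun p => a p.1 p.2)); last first.
  by rewrite setTT_bijective; exact: bijTT.
transitivity (\esum_(k in [set: nat] `*`` (fun=> [set: nat])) a k.1 k.2).
  by congr esum; apply/seteqP; split.
rewrite -esum_esum//; rewrite nneseries_esumT; last first.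
  by move=> i; apply: nneseries_ge0.
by apply: eq_esum => i _; rewrite nneseries_esumT.
Qed.

Lemma nneseries_le_bound (u : nat -> \bar R) c :
  (forall n, 0 <= u n) -> (forall n, \sum_(i < n) u i <= c) ->
  \sum_(i <oo) u i <= c.
Proof.
move=> u0 uc; apply: lime_le; first by apply: is_cvg_nneseries.
by apply: nearW => n; rewrite big_mkord.
Qed.

End DoubleSeries.

Section Bowen.
Context {R : realType} (X : pmetricType R) (T : X -> X).
Implicit Types (Z : set X) (eps s : R).

Lemma cover_weight_term_ge0 s (o : option (X * nat)) :
  (0 <= (if o is Some (x, m) then (expR (- s * m%:R))%:E else 0))%E.
Proof. by case: o => [[x m]|//]; rewrite lee_fin expR_ge0. Qed.
Hint Resolve cover_weight_term_ge0 : core.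

Lemma cover_weight_ge0 s (c : nat -> option (X * nat)) : (0 <= cover_weight s c)%E.
Proof. exact: nneseries_ge0. Qed.

Lemma bowen_cover_bigcup (Z : set X) (Y : nat -> set X) eps N s c :
  Z `<=` \bigcup_i Y i -> (forall i, bowen_cover T (Y i) eps N (c i)) ->
  exists c', bowen_cover T Z eps N c' /\
    cover_weight s c' = (\sum_(i <oo) cover_weight s (c i))%E.
Proof.
move=> ZY cY; have [e [e_surj sum_e]] := @nneseries_pairing R.
exists (fun k => c (e k).1 (e k).2); split; first split.
- by move=> k x m; apply: (cY (e k).1).1.
- move=> x /ZY[i _ /(cY i).2[j [y [m [cij yx]]]]].
  by have [k ek] := e_surj (i, j); exists k, y, m; rewrite ek.
- rewrite /cover_weight (sum_e (fun i j => if c i j is Some (x, m) then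
     (expR (- s * m%:R))%:E else 0%E))//.
Qed.

Lemma bowen_HN_ge0 s Z eps N : (0 <= bowen_HN T s Z eps N)%E.
Proof. by apply: le_ereal_inf_tmp => _ [c _ <-]; exact: cover_weight_ge0. Qed.

Lemma bowen_HN_nd s Z eps : nondecreasing_seq (bowen_HN T s Z eps).
Proof.
move=> N M NM; apply: ereal_inf_le_tmp => _ [c [cM cZ] <-]; exists c => //; split => // i x m.
by move=> /cM; apply: leq_trans.
Qed.

(** [bowen_HN] is nonnegative and nondecreasing in [N], so the limit is a supremum and vanishes only
    if every term does. *)
Lemma bowen_H_eq0P s Z eps : bowen_H T s Z eps = 0%E <->
  forall N (d : R), 0 < d ->
    exists c, bowen_cover T Z eps N c /\ (cover_weight s c <= d%:E)%E.
Proof.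
split => [H0 N d d0|Hd].
  have : (bowen_HN T s Z eps N < d%:E)%E.
    apply: (@le_lt_trans _ _ 0%E); last by rewrite lte_fin.
    have /cvg_lim HNsup := ereal_nondecreasing_cvgn (bowen_HN_nd s Z eps).
    move: H0; rewrite /bowen_H HNsup// => <-.
    by apply: ereal_sup_ubound; exists N.
  by move=> /ereal_inf_lt[_ [c cZ <-]] /ltW; exists c.
rewrite /bowen_H; have -> : bowen_HN T s Z eps = fun=> 0%E.
  apply/funext => N; apply/eqP; rewrite eq_le bowen_HN_ge0 andbT.
  apply/lee_addgt0Pr => d d0; rewrite add0e.
  have [c [cZ cd]] := Hd N d d0.
  by apply: le_trans cd; apply: ereal_inf_lbound; exists c.
exact: lim_cst.
Qed.

Lemma bowen_H_eq0_subset s Y Z eps eps' : Y `<=` Z -> eps' <= eps ->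
  bowen_H T s Z eps' = 0%E -> bowen_H T s Y eps = 0%E.
Proof.
move=> YZ ee /bowen_H_eq0P HZ; apply/bowen_H_eq0P => N d d0.
have [c [[cN cZ] cd]] := HZ N d d0; exists c; split => //; split => // x /YZ/cZ.
move=> [i [y [m [ci xy]]]]; exists i, y, m; split => // j jm.
exact: lt_le_trans (xy j jm) ee.
Qed.

(** Covers of weight at most [d / 2 ^ i.+1] are merged. This countable stability absorbs the
    countably many weight functions of the upper bound. *)
Lemma bowen_H_bigcup_eq0 s (Y : nat -> set X) Z eps : Z `<=` \bigcup_i Y i ->
  (forall i, bowen_H T s (Y i) eps = 0%E) -> bowen_H T s Z eps = 0%E.
Proof.
move=> ZY HY; apply/bowen_H_eq0P => N d d0.
have : forall i, exists c, bowen_cover T (Y i) eps N c /\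
    (cover_weight s c <= (d / (2 ^ i.+1)%:R)%:E)%E.
  move=> i; have /bowen_H_eq0P := HY i; apply.
  by rewrite divr_gt0// ltr0n expn_gt0.
move=> /choice[c cP].
have [c' [c'Z c'w]] := bowen_cover_bigcup s ZY (fun i => (cP i).1).
exists c'; split => //; rewrite c'w.
apply: (le_trans _ (epsilon_trick0 xpredT (ltW d0))).
by apply: lee_nneseries => [i _ _|i _]; [exact: cover_weight_ge0|exact: (cP i).2].
Qed.

Lemma htop_eps_subset Y Z eps eps' : Y `<=` Z -> eps' <= eps ->
  (htop_eps T Y eps <= htop_eps T Z eps')%E.
Proof.
move=> YZ ee; apply: ereal_inf_le_tmp => _ [s /= sZ <-]; exists s => //.
exact: bowen_H_eq0_subset sZ.
Qed.

Lemma htopE Z : htop T Z = ereal_sup [set htop_eps T Z eps | eps in [set eps | 0 < eps]].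
Proof.
have ni : {in Interval (BRight 0) (BInfty R false) &, nonincreasing_fun (htop_eps T Z)}.
  by move=> e e' _ _; exact: htop_eps_subset.
have /cvg_lim htop_sup :=
  @nonincreasing_at_right_cvge R (htop_eps T Z) 0 (BInfty R false) isT ni.
rewrite /htop htop_sup//.
congr (ereal_sup (_ @` _)); apply/seteqP; split => e /=; rewrite in_itv/= ?andbT//.
Qed.

Lemma htop_subset Y Z : Y `<=` Z -> (htop T Y <= htop T Z)%E.
Proof.
move=> YZ; rewrite !htopE; apply: ge_ereal_sup => _ [e e0 <-].
apply: (le_trans (htop_eps_subset YZ (lexx e))).
by apply: ereal_sup_ubound; exists e.
Qed.

Lemma htop_le Z (a : \bar R) :
  (forall s eps, (a < s%:E)%E -> 0 < eps -> bowen_H T s Z eps = 0%E) ->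
  (htop T Z <= a)%E.
Proof.
move=> aZ; rewrite htopE; apply: ge_ereal_sup => _ [e /= e0 <-].
have le_s s : (a < s%:E)%E -> (htop_eps T Z e <= s%:E)%E.
  by move=> as_; apply: ereal_inf_lbound; exists s => //=; exact: aZ.
case: a {aZ} le_s => [a| |] le_s.
- apply/lee_addgt0Pr => d d0; rewrite -EFinD; apply: le_s.
  by rewrite lte_fin ltrDl.
- by rewrite leey.
- case: (htop_eps T Z e) le_s => [r| |//] le_s.
    by have := le_s (r - 1)%R (ltNyr _); rewrite lee_fin lerBrDl gerDr ler10.
  by have := le_s 0%R (ltNyr _); rewrite leye_eq.
Qed.

(** A Borel-Cantelli argument: the balls around all points of [L n], over all [n >= N0], cover [Z],
    and their total weight is at most the geometric tail [C * q ^ N0 / (1 - q)]. *)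
Lemma bowen_H_limsup_eq0 s eps Z (L : nat -> seq X) (C q : R) :
  0 <= C -> 0 < q -> q < 1 ->
  (forall n, (size (L n))%:R * expR (- s * n%:R) <= C * q ^+ n) ->
  (forall x, Z x -> forall N, exists2 n, (N <= n)%N &
     exists2 y, y \in L n & bowen_ball T n y eps x) ->
  bowen_H T s Z eps = 0%E.
Proof.
move=> C0 q0 q1 LC ZL; apply/bowen_H_eq0P => N d d0.
have [N0 NN0 N0d] : exists2 N0, (N <= N0)%N & C * q ^+ N0 / (1 - q) <= d.
  have : (fun n => C * q ^+ n / (1 - q)) @ \oo --> (0 : R).
    rewrite [X in _ --> X](_ : 0 = C * 0 / (1 - q)); last by rewrite mulr0 mul0r.
    apply: cvgMl; apply: cvgMr; apply: cvg_expr.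
    by rewrite gtr0_norm.
  move=> /cvgrPdist_le/(_ d d0)[N1 _ N1d].
  exists (maxn N N1); first exact: leq_maxl.
  have := N1d (maxn N N1) (leq_maxr _ _).
  by rewrite sub0r normrN => /(le_trans (ler_norm _)).
(* [onth] gives [None] beyond the end of a list, which turns each finite list into an infinite
   optional family. *)
pose c n i := omap (fun y => (y, (N0 + n)%N)) (onth (L (N0 + n)%N) i).
pose Y n := [set x | exists2 y, y \in L (N0 + n)%N & bowen_ball T (N0 + n)%N y eps x].
have ZY : Z `<=` \bigcup_n Y n.
  move=> x /ZL/(_ N0)[n N0n [y yL xy]]; exists (n - N0)%N => //=.
  by exists y; rewrite subnKC.
have cY n : bowen_cover T (Y n) eps N (c n).
  split => [i x m|x [y yL xy]].
    rewrite /c; case: onth => //= z [_ <-].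
    by rewrite (leq_trans NN0)// leq_addr.
  by have /onthP[i yi] := yL; exists i, y, (N0 + n)%N; rewrite /c yi.
have [c' [c'Z c'w]] := bowen_cover_bigcup s ZY cY.
exists c'; split => //; rewrite c'w.
have cw n : (cover_weight s (c n) <= (C * q ^+ N0 * q ^+ n)%:E)%E.
  rewrite -mulrA -exprD; apply: le_trans (_ : ((size (L (N0 + n)%N))%:R * expR (- s * (N0 + n)%N%:R))%:E <= _)%E; last first.
    by rewrite lee_fin LC.
  apply: nneseries_le_bound => // m.
  pose v := expR (- s * (N0 + n)%N%:R).
  apply: (@le_trans _ _ (\sum_(i < m) ((i < size (L (N0 + n)%N))%N%:R * v)%:E)%E).
    apply: lee_sum => i _; rewrite /c.
    case: ltnP => im; last by rewrite onth_default// mul0r.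
    by case: onth => [y|] /=; rewrite mul1r lee_fin// expR_ge0.
  rewrite sumEFin lee_fin -mulr_suml ler_wpM2r ?expR_ge0//.
  rewrite -natr_sum ler_nat.
  suff -> k : (\sum_(i < m) (i < k) = minn m k)%N by rewrite geq_minr.
  elim: m => [|m IHm]; first by rewrite big_ord0 min0n.
  by rewrite big_ord_recr/= IHm; lia.
apply: (@le_trans _ _ (C * q ^+ N0 / (1 - q))%:E); last by rewrite lee_fin.
apply: nneseries_le_bound => [n|n]; first exact: cover_weight_ge0.
apply: (@le_trans _ _ (\sum_(i < n) (C * q ^+ N0 * q ^+ i)%:E)%E).
  by apply: lee_sum => i _.
rewrite sumEFin lee_fin -mulr_sumr ler_wpM2l ?mulr_ge0 ?exprn_ge0 ?(ltW q0)//.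
rewrite -[leRHS]mul1r ler_pdivlMr ?subr_gt0// mulrC.
have := subrX1 q n => /(congr1 -%R); rewrite -mulNr !opprB => <-.
by rewrite gerBl exprn_ge0 ?(ltW q0).
Qed.

End Bowen.

(** * The Riesz measure on a compact metric space *)

Section ContinuousIntegral.
Context {R : realType} {X : pmetricType R}.
Implicit Types f g : X -> R.

Lemma continuous_borel_measurable f : continuous f ->
  measurable_fun setT (f : borel X -> R).
Proof.
move=> /continuousP cf; apply: (measurability _ (measurable_realfun.RGenOpens.measurableE R)).
move=> _ [_ [a [b ->] <-]]; rewrite setTI.
by apply: sub_sigma_algebra; exact/cf/interval_open.
Qed.

Lemma open_borel_measurable (A : set X) : open A -> measurable (A : set (borel X)).
Proof. exact: sub_sigma_algebra. Qed.

Lemma continuous_sum n (f : nat -> X -> R) : (forall i, continuous (f i)) ->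
  continuous (fun x => \sum_(i < n) f i x).
Proof.
by move=> cf x; apply: (cvg_big add_continuous) => i _; exact: cf.
Qed.

Lemma continuous_preimage_borel (T : X -> X) (A : set (borel X)) : continuous T ->
  measurable A -> measurable (T @^-1` A : set (borel X)).
Proof.
move=> /continuousP cT mA.
suff : [set B : set X | measurable (T @^-1` B : set (borel X))] A by [].
move: A mA; apply: smallest_sub => [|U oU]; last by apply: open_borel_measurable; exact: cT.
split => [|B /= mB|F mF] /=.
- by rewrite preimage_set0.
- by rewrite setTD preimage_setC; exact: measurableC.
- by rewrite preimage_bigcup; apply: bigcup_measurable => k _; exact: mF.
Qed.

Hypothesis cX : compact [set: X].

Lemma continuous_bound f : continuous f -> exists2 M, 0 < M & forall x, `|f x| <= M.
Proof.
move=> cf.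
have /compact_bounded[M [_ Mf]] : compact (f @` setT).
  by apply: continuous_compact => //; exact: continuous_subspaceT.
exists (`|M| + 1); first by rewrite ltr_wpDl.
move=> x; apply: Mf; last by exists x.
by rewrite (le_lt_trans (ler_norm _))// ltrDl.
Qed.

Variable mu : probability (borel X) R.

Lemma continuous_integrable f : continuous f -> mu.-integrable setT (EFin \o f).
Proof.
move=> cf; apply: measurable_bounded_integrable => //.
- by rewrite ltey_eq fin_num_measure.
- exact: continuous_borel_measurable.
- have [M _ fM] := continuous_bound cf.
  exists M; split; [exact: num_real|] => y My x _ /=; exact: le_trans (fM x) (ltW My).
Qed.

Local Notation I := (Rintegral mu setT).

Lemma Rintegral1 (c : R) : I (fun=> c) = c.
Proof.
rewrite Rintegral_cst// [X in _ * X](_ : _ = 1) ?mulr1//.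
exact: (congr1 fine (probability_setT mu)).
Qed.

Lemma Rintegral_contD f g : continuous f -> continuous g ->
  I (fun x => f x + g x) = I f + I g.
Proof. by move=> cf cg; apply: RintegralD => //; exact: continuous_integrable. Qed.

Lemma Rintegral_contB f g : continuous f -> continuous g ->
  I (fun x => f x - g x) = I f - I g.
Proof. by move=> cf cg; apply: RintegralB => //; exact: continuous_integrable. Qed.

Lemma Rintegral_contZ c f : continuous f -> I (fun x => c * f x) = c * I f.
Proof. by move=> cf; apply: RintegralZl => //; exact: continuous_integrable. Qed.

Lemma Rintegral_cont_sum n (f : nat -> X -> R) : (forall i, continuous (f i)) ->
  I (fun x => \sum_(i < n) f i x) = \sum_(i < n) I (f i).
Proof.
move=> cf; elim: n => [|n IHn].
  by under eq_Rintegral do rewrite big_ord0; rewrite big_ord0 Rintegral1.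
under eq_Rintegral do rewrite big_ord_recr/=.
by rewrite Rintegral_contD ?IHn ?big_ord_recr//; exact: continuous_sum.
Qed.

Lemma le_Rintegral_cont f g : continuous f -> continuous g ->
  (forall x, f x <= g x) -> I f <= I g.
Proof. by move=> cf cg fg; apply: le_Rintegral => //; exact: continuous_integrable. Qed.

Lemma Rintegral_indicE (A : set (borel X)) : measurable A -> I (\1_A) = fine (mu A).
Proof. by move=> mA; rewrite /Rintegral integral_indic// setIT. Qed.

Lemma Rintegral_le_measure f (A : set (borel X)) : continuous f -> measurable A ->
  (forall x, f x <= \1_A x) -> I f <= fine (mu A).
Proof.
move=> cf mA fA; rewrite -Rintegral_indicE//; apply: le_Rintegral => //.
  exact: continuous_integrable.
by apply: integrable_indic.
Qed.

Lemma measure_le_Rintegral f (A : set (borel X)) : continuous f -> measurable A ->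
  (forall x, \1_A x <= f x) -> fine (mu A) <= I f.
Proof.
move=> cf mA fA; rewrite -Rintegral_indicE//; apply: le_Rintegral => //.
- by apply: integrable_indic.
- exact: continuous_integrable.
- by move=> x _; exact: fA.
Qed.

End ContinuousIntegral.

Section Distance.
Context {R : realType} {X : pmetricType R}.

Lemma mdist_continuous (p : X) : continuous (mdist p).
Proof.
move=> x; apply/cvgrPdist_lt => e e0.
apply/nbhs_ballP; exists e => //= y; rewrite ballEmdist/= => xy.
have yx := metric_triangle p y x; rewrite (metric_sym y x) in yx.
by have xy' := metric_triangle p x y; rewrite ltr_norml; lra.
Qed.

(** [h] is the distance to the complement, or the constant 1 when the complement is empty. *)
Lemma open_positive_set (U : set X) : open U ->
  exists2 h : X -> R, continuous h &
    (forall x, 0 <= h x) /\ U = [set x | 0 < h x].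
Proof.
move=> oU; have [UT|/set0P[z0 z0U]] := eqVneq (~` U) set0.
  exists (fun=> 1) => //; first exact: cst_continuous.
  split => //; apply/seteqP; split => x //= _.
  by apply: contrapT => Ux; have : (~` U) x by []; rewrite UT.
pose D x := [set mdist x z | z in ~` U].
have lD x : has_lbound (D x) by exists 0 => _ [z _ <-]; exact: mdist_ge0.
have D0 x : D x !=set0 by exists (mdist x z0), z0.
exists (fun x => inf (D x)).
  move=> x; apply/cvgrPdist_le => e e0.
  apply/nbhs_ballP; exists e => //= y; rewrite ballEmdist/= => xy.
  have lip a b : inf (D a) <= mdist a b + inf (D b).
    rewrite -lerBlDl; apply: lb_le_inf => // _ [z zU <-].
    rewrite lerBlDl (le_trans _ (metric_triangle a b z))//.
    by apply: ge_inf => //; exists z.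
  have yx := lip y x; rewrite (metric_sym y x) in yx.
  by have xy' := lip x y; rewrite ler_norml; lra.
split; first by move=> x; apply: lb_le_inf => // _ [z _ <-]; exact: mdist_ge0.
apply/seteqP; split => x /=.
  move=> Ux; have := open_nbhs_nbhs (conj oU Ux) => /nbhs_ballP[e /= e0 eU].
  apply: (lt_le_trans e0); apply: lb_le_inf => // _ [z zU <-].
  by rewrite leNgt; apply/negP => xz; apply/zU/eU; rewrite ballEmdist.
move=> hx; apply: contrapT => xU; move: hx; rewrite ltNge => /negP; apply.
by apply: ge_inf => //; exists x => //; rewrite mdistxx.
Qed.

End Distance.

(** * The measure of a normalized positive functional *)

Section Riesz.
Context {R : realType} {X : pmetricType R}.
Hypothesis cX : compact [set: X].
Variable L : (X -> R) -> R.
Hypotheses (L1 : L (fun=> 1) = 1)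
  (LD : forall f g : X -> R, continuous f -> continuous g -> L (fun x => f x + g x) = L f + L g)
  (LZ : forall (c : R) (f : X -> R), continuous f -> L (fun x => c * f x) = c * L f)
  (L_ge0 : forall f : X -> R, continuous f -> (forall x, 0 <= f x) -> 0 <= L f).

Let LB (f g : X -> R) : continuous f -> continuous g -> L (fun x => f x - g x) = L f - L g.
Proof.
move=> cf cg; have := @LD f (fun x => -1 * g x) cf.
rewrite LZ// mulN1r => <-; first by congr L; apply/funext => x; rewrite mulN1r.
by move=> x; apply: cvgMr; exact: cg.
Qed.

Let L_le (f g : X -> R) : continuous f -> continuous g -> (forall x, f x <= g x) -> L f <= L g.
Proof.
move=> cf cg fg; rewrite -subr_ge0 -LB//; apply: L_ge0 => [x|x].
  by apply: cvgB; [exact: cg|exact: cf].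
by rewrite subr_ge0.
Qed.

Let L_cst c : L (fun=> c) = c.
Proof.
rewrite -[RHS]mulr1 -L1 -LZ; last exact: cst_continuous.
by congr L; apply/funext => x; rewrite mulr1.
Qed.

Let L_sum n (f : nat -> X -> R) : (forall i, continuous (f i)) ->
  L (fun x => \sum_(i < n) f i x) = \sum_(i < n) L (f i).
Proof.
move=> cf; elim: n => [|n IHn].
  rewrite big_ord0 -[RHS](L_cst 0); congr L.
  by apply/funext => x; rewrite big_ord0.
rewrite big_ord_recr/= -IHn -LD//.
  by congr L; apply/funext => x; rewrite big_ord_recr.
exact: continuous_sum.
Qed.

(** Covering by countable families of functions, as in the Daniell construction, lets the outer
    measure be read off from [L] without passing through open sets. *)
Definition riesz_cover (A : set X) (f : nat -> X -> R) :=
  [/\ forall m, continuous (f m), forall m x, 0 <= f m x &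
      forall x, A x -> (1 <= \sum_(m <oo) (f m x)%:E)%E].

Definition riesz_outer (A : set X) : \bar R :=
  ereal_inf [set (\sum_(m <oo) (L (f m))%:E)%E | f in riesz_cover A].

Lemma riesz_outer_le2 A (f : nat -> nat -> X -> R) :
  (forall i j, continuous (f i j)) -> (forall i j x, 0 <= f i j x) ->
  (forall x, A x -> (1 <= \sum_(i <oo) \sum_(j <oo) (f i j x)%:E)%E) ->
  (riesz_outer A <= \sum_(i <oo) \sum_(j <oo) (L (f i j))%:E)%E.
Proof.
move=> cf f0 fA; have [e [_ sum_e]] := @nneseries_pairing R.
rewrite -(sum_e (fun i j => (L (f i j))%:E)); last by move=> i j; rewrite lee_fin L_ge0.
apply: ereal_inf_lbound; exists (fun k => f (e k).1 (e k).2) => //; split => // x Ax.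
rewrite (sum_e (fun i j => (f i j x)%:E)); last by move=> i j; rewrite lee_fin.
exact: fA.
Qed.

Lemma riesz_outer_le A (f : nat -> X -> R) : riesz_cover A f ->
  (riesz_outer A <= \sum_(i <oo) (L (f i))%:E)%E.
Proof. by move=> fA; apply: ereal_inf_lbound; exists f. Qed.

Lemma riesz_outer_le_fun (A : set X) (f : X -> R) : continuous f -> (forall x, 0 <= f x) ->
  (forall x, A x -> 1 <= f x) -> (riesz_outer A <= (L f)%:E)%E.
Proof.
move=> cf f0 fA; pose g m := if m is 0%N then f else fun=> 0.
have sumg (u : (X -> R) -> R) : u (fun=> 0) = 0 -> (forall m, 0 <= u (g m)) ->
    (\sum_(m <oo) (u (g m))%:E = (u f)%:E)%E.
  move=> u0 ug; rewrite nneseries_recl//; last by move=> m; rewrite lee_fin.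
  by rewrite eseries_cond/= eseries0 ?adde0// => -[|m]//= _ _; rewrite u0.
rewrite -(sumg L); first apply: riesz_outer_le.
- split=> [[|m]|[|m] x|x Ax] //=; first exact: cst_continuous.
  rewrite (sumg (fun f => f x))//; first by rewrite lee_fin fA.
  by case.
- by rewrite L_cst.
- by case=> [|m]; rewrite ?L_cst// L_ge0.
Qed.

Lemma riesz_outer_ge0 A : (0 <= riesz_outer A)%E.
Proof.
apply: le_ereal_inf_tmp => _ [f [cf f0 _] <-].
by apply: nneseries_ge0 => m _ _; rewrite lee_fin L_ge0.
Qed.

Lemma riesz_outer_le1 A : (riesz_outer A <= 1)%E.
Proof. by rewrite -[1%E]/(1%:E) -L1; apply: riesz_outer_le_fun => //; exact: cst_continuous. Qed.

Lemma riesz_outer_fin_num A : riesz_outer A \is a fin_num.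
Proof.
rewrite ge0_fin_numE ?riesz_outer_ge0// (le_lt_trans (riesz_outer_le1 A))//.
exact: ltry.
Qed.

Lemma riesz_cover_adherent A (e : R) : 0 < e -> exists2 f, riesz_cover A f &
  (\sum_(m <oo) (L (f m))%:E <= riesz_outer A + e%:E)%E.
Proof.
move=> e0; have [_ [f fA <-] /ltW fe] := lb_ereal_inf_adherent e0 (riesz_outer_fin_num A).
by exists f.
Qed.

Lemma riesz_outer0 : riesz_outer set0 = 0%E.
Proof.
apply/eqP; rewrite eq_le riesz_outer_ge0 andbT -[0%E]/(0%:E) -[in leRHS](L_cst 0).
by apply: riesz_outer_le_fun => //; exact: cst_continuous.
Qed.

Lemma ge_nneseries_term (u : nat -> \bar R) n :
  (forall i, (0 <= u i)%E) -> (u n <= \sum_(i <oo) u i)%E.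
Proof.
by move=> u0; rewrite (@nneseriesD1 _ u n xpredT)// leeDl// nneseries_ge0.
Qed.

Lemma riesz_outer_subadditive A F : subset_sigma_subadditive riesz_outer A F.
Proof.
move=> AF; apply/lee_addgt0Pr => e e0.
have /choice[f fP] : forall n, exists f, riesz_cover (F n) f /\
    (\sum_(m <oo) (L (f m))%:E <= riesz_outer (F n) + (e / (2 ^ n.+1)%:R)%:E)%E.
  move=> n; have [|f fF fe] := @riesz_cover_adherent (F n) (e / (2 ^ n.+1)%:R).
    by rewrite divr_gt0// ltr0n expn_gt0.
  by exists f.
have cf i j : continuous (f i j) by have [[+ _ _] _] := fP i; exact.
have f0 i j x : 0 <= f i j x by have [[_ + _] _] := fP i; exact.
apply: (@le_trans _ _ (\sum_(i <oo) \sum_(j <oo) (L (f i j))%:E)%E).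
  apply: riesz_outer_le2 => // x /AF[n _ Fnx].
  have [[_ _ fF] _] := fP n; apply: (le_trans (fF x Fnx)).
  apply: (@ge_nneseries_term (fun i => \sum_(j <oo) (f i j x)%:E)%E) => i.
  by apply: nneseries_ge0 => j _ _; rewrite lee_fin.
apply: (le_trans _ (epsilon_trick xpredT (fun n => riesz_outer_ge0 (F n)) (ltW e0))).
apply: lee_nneseries => [i _ _|i _]; last exact: (fP i).2.
by apply: nneseries_ge0 => j _ _; rewrite lee_fin L_ge0.
Qed.

HB.instance Definition _ := isSubsetOuterMeasure.Build R X riesz_outer
  riesz_outer0 riesz_outer_ge0 riesz_outer_subadditive.


(* With [g k] increasing to the indicator of [U], a cover [f] of [A] is split into
   the functions [f m * g (k m)], whose telescoped versions cover [A `&` U], and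
   [f m * (1 - g (k m))], which cover [A `&` ~` U]. *)
Lemma riesz_caratheodory_open (U : set X) : open U ->
  riesz_outer.-caratheodory U.
Proof.
move=> oU; apply: le_caratheodory_measurable => A.
have [h ch [h0 Uh]] := open_positive_set oU.
apply/lee_addgt0Pr => e e0; have e20 : 0 < e / 2 by rewrite divr_gt0.
have [f [cf f0 fA] fe] := riesz_cover_adherent A e20.
pose g k x := Num.min 1 (k%:R * h x).
have cg k : continuous (g k).
  move=> x; apply: (@continuous_min _ _ (fun=> 1) (fun x => k%:R * h x)).
    exact: cvg_cst.
  by apply: cvgMr; exact: ch.
have g0 k x : 0 <= g k x by rewrite le_min ler01 mulr_ge0.
have g1 k x : g k x <= 1 by rewrite ge_min lexx.
have gS k x : g k x <= g k.+1 x.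
  by rewrite le_min g1/= ge_min ler_wpM2r ?ler_nat// orbT.
have gU x : U x -> exists k, g k x = 1.
  rewrite Uh /= => hx; exists (Num.truncn (h x)^-1).+1.
  apply/eqP; rewrite eq_le g1 le_min lexx/= -ler_pdivrMr// mul1r.
  by rewrite ltW// truncnS_gt.
have gUC k x : (~` U) x -> g k x = 0.
  rewrite Uh /= => /negP; rewrite -leNgt => hx.
  have hx0 : h x = 0 by apply/eqP; rewrite eq_le hx h0.
  by rewrite /g hx0 mulr0 min_r.
have cfg m k : continuous (fun x => f m x * g k x).
  by move=> x; apply: cvgM; [exact: cf|exact: cg].
(* [sup (S m)] bounds [L] of every partial sum of the telescoped series for [f m], and the level
   [k m] nearly attains it, so both halves of the split can be compared at that level. *)
pose S m := [set L (fun x => f m x * g k x) | k in setT].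
have supS m : has_sup (S m).
  split; first by exists (L (fun x => f m x * g 0 x)), 0%N.
  exists (L (f m)) => _ [k _ <-]; apply: L_le => // x.
  by rewrite ler_piMr.
have /choice[k kP] : forall m, exists k,
    sup (S m) <= L (fun x => f m x * g k x) + (e / 2 / (2 ^ m.+1)%:R).
  move=> m; have [|_ [k _ <-] /ltW] := @sup_adherent _ (S m) (e / 2 / (2 ^ m.+1)%:R) _ (supS m).
    by rewrite divr_gt0// ltr0n expn_gt0.
  by rewrite lerBlDr; exists k.
have AU : (riesz_outer (A `&` U) <= \sum_(m <oo)
    (L (fun x => f m x * g (k m) x) + e / 2 / (2 ^ m.+1)%:R)%:E)%E.
  (* The telescoping starts at [g 0 = 0], so the partial sums are [f m * g n], which at a point of
     [U] equal [f m] for some [n]. *)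
  pose phi m i x := f m x * (g i.+1 x - g i x).
  have cphi m i : continuous (phi m i).
    by move=> x; apply: cvgM; [exact: cf|apply: cvgB; exact: cg].
  have phi0 m i x : 0 <= phi m i x by rewrite mulr_ge0// subr_ge0.
  have sum_phi m n x : \sum_(i < n) phi m i x = f m x * g n x.
    elim: n => [|n IHn]; first by rewrite big_ord0 /g mul0r min_r ?mulr0.
    by rewrite big_ord_recr/= IHn /phi; ring.
  apply: (le_trans (riesz_outer_le2 cphi phi0 _)).
    move=> x [Ax Ux]; apply: (le_trans (fA x Ax)).
    apply: lee_nneseries => [m _ _|m _]; first by rewrite lee_fin.
    have [n gn] := gU x Ux.
    have : (\sum_(0 <= i < n) (phi m i x)%:E <= \sum_(i <oo) (phi m i x)%:E)%E.
      by apply: nneseries_lim_ge => i _ _; rewrite lee_fin.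
    by rewrite big_mkord sumEFin sum_phi gn mulr1.
  apply: lee_nneseries => [m _ _|m _].
    by apply: nneseries_ge0 => i _ _; rewrite lee_fin L_ge0.
  apply: nneseries_le_bound => [i|n]; first by rewrite lee_fin L_ge0.
  rewrite sumEFin -L_sum// lee_fin (le_trans _ (kP m))//.
  apply: ub_le_sup; first exact: (supS m).2.
  by exists n => //; congr L; apply/funext => x; rewrite sum_phi.
have AUC : (riesz_outer (A `&` ~` U) <= \sum_(m <oo)
    (L (fun x => f m x - f m x * g (k m) x))%:E)%E.
  apply: riesz_outer_le; split => [m|m x|x [Ax Ux]].
  - by move=> x; apply: cvgB; [exact: cf|exact: cfg].
  - by rewrite subr_ge0 ler_piMr.
  - apply: (le_trans (fA x Ax)); apply: lee_nneseries => [m _ _|m _].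
      by rewrite lee_fin.
    by rewrite gUC// mulr0 subr0.
apply: (le_trans (leeD AU AUC)).
rewrite -nneseriesD; last 2 first.
- move=> m _ _; rewrite lee_fin addr_ge0 ?divr_ge0 ?(ltW e0) ?ler0n//.
  by rewrite L_ge0// => x; rewrite mulr_ge0.
- move=> m _ _; rewrite lee_fin LB//.
  by rewrite subr_ge0 L_le// => x; rewrite ler_piMr.
(* One half of [e] pays for the choice of [f], the other for the levels [k m]. *)
rewrite [e in leRHS]splitr EFinD addeA.
apply: le_trans (leeD fe (lexx _)).
apply: le_trans (epsilon_trick xpredT _ (ltW e20)); last first.
  by move=> m; rewrite lee_fin L_ge0.
apply: lee_nneseries => [m _ _|m _].
  rewrite -EFinD lee_fin !addr_ge0 ?divr_ge0 ?(ltW e0) ?ler0n//.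
    by rewrite L_ge0// => x; rewrite mulr_ge0.
  by rewrite LB// subr_ge0 L_le// => x; rewrite ler_piMr.
by rewrite -!EFinD lee_fin LB//; lra.
Qed.

Lemma riesz_caratheodory_borel (A : set (borel X)) : measurable A ->
  riesz_outer.-caratheodory A.
Proof.
apply: smallest_sub => [|U oU]; last exact: riesz_caratheodory_open.
split => [|B mB|F mF].
- exact: caratheodory_measurable_set0.
- by rewrite setTD; exact: caratheodory_measurable_setC.
- exact: caratheodory_measurable_bigcup.
Qed.

Definition riesz_measure (A : set (borel X)) : \bar R := riesz_outer A.

Let riesz_measure0 : riesz_measure set0 = 0%E. Proof. exact: riesz_outer0. Qed.

Let riesz_measure_ge0 A : (0 <= riesz_measure A)%E. Proof. exact: riesz_outer_ge0. Qed.

Let riesz_measure_semi_sigma_additive : semi_sigma_additive riesz_measure.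
Proof.
move=> F mF tF mUF.
apply: (@caratheodory_measure_sigma_additive R X (riesz_outer)) => //.
  by move=> i; exact: riesz_caratheodory_borel.
exact: riesz_caratheodory_borel.
Qed.

HB.instance Definition _ := isMeasure.Build _ _ _ riesz_measure
  riesz_measure0 riesz_measure_ge0 riesz_measure_semi_sigma_additive.

(** By compactness, as in Dini's theorem, some partial sum of a cover of [X] is at least [1 - e]
    everywhere; positivity of [L] then bounds the [L]-sum of the cover from below. *)
Let riesz_measure_setT : riesz_measure setT = 1%E.
Proof.
apply/eqP; rewrite eq_le riesz_outer_le1/=.
apply: le_ereal_inf_tmp => _ [f [cf f0 fX] <-].
apply/lee_addgt0Pr => e e0.
have : \forall n \near \oo, [set: X] `<=` (fun x => 1 - e <= \sum_(i < n) f i x).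
  have /compact_near_coveringP nX := cX.
  apply: (nX nat \oo (fun n x => 1 - e <= \sum_(i < n) f i x)) => x _.
  have [n xn] : exists n, 1 - e < \sum_(i < n) f i x.
    apply: contrapT => /forallNP xn; have := fX x I; apply/negP; rewrite -ltNge.
    apply: (@le_lt_trans _ _ (1 - e)%:E); last by rewrite lte_fin gtrBl.
    apply: nneseries_le_bound => [i|n]; first by rewrite lee_fin.
    by rewrite sumEFin lee_fin leNgt; apply/negP/xn.
  have cs : continuous (fun x => \sum_(i < n) f i x) by exact: continuous_sum.
  near=> y m => /=.
  have yn : 1 - e < \sum_(i < n) f i y.
    near: y; have := cs x; move=> /cvgr_gt; exact.
  apply: (le_trans (ltW yn)).
  rewrite -(big_mkord xpredT (f ^~ y)) -(big_mkord xpredT (f ^~ y)).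
  rewrite [leRHS](big_cat_nat _ (n := n)) //=; first by rewrite lerDl sumr_ge0.
  by near: m; exists n.
case=> n _ /(_ n (leqnn _)) nX.
have : 1 - e <= \sum_(i < n) L (f i).
  rewrite -L_sum// -[leLHS]L_cst; apply: L_le; [exact: cst_continuous|exact: continuous_sum|].
  by move=> x; exact: nX.
rewrite lerBlDr -lee_fin EFinD => /le_trans; apply; rewrite leeD2r// -sumEFin -(big_mkord xpredT (fun i => (L (f i))%:E)).
by apply: nneseries_lim_ge => i _ _; rewrite lee_fin L_ge0.
Unshelve. all: by end_near. Qed.

HB.instance Definition _ := Measure_isProbability.Build _ _ _ riesz_measure
  riesz_measure_setT.

Local Notation I := (Rintegral riesz_measure setT).

(** The [i]-th term is the length of the part of [[0, t]] inside [[i, i + 1]]. *)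
Lemma sum_clamp (t : R) n : 0 <= t ->
  \sum_(i < n) Num.max 0 (Num.min 1 (t - i%:R)) = Num.min t n%:R.
Proof.
move=> t0; elim: n => [|n IHn]; first by rewrite big_ord0 min_r.
rewrite big_ord_recr/= IHn -natr1 /Order.max /Order.min.
have n0 : 0 <= n%:R :> R := ler0n _ _.
by case: (ltP 1 (t - n%:R)) => ?; repeat case: ltP => ?; lra.
Qed.

(* Slice [f] into [n] layers [h i / n]: the layer [h i.+1] is dominated by the
   indicator of the open set [A i = {n f > i + 1}], on which [h i = 1]. *)
Lemma riesz_measure_integral_le (f : X -> R) : continuous f ->
  (forall x, 0 <= f x) -> (forall x, f x <= 1) -> I f <= L f.
Proof.
move=> cf f0 f1; apply/ler_addgt0Pr => e e0.
pose n := (Num.truncn e^-1).+1.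
have n0 : 0 < n%:R :> R by rewrite ltr0n.
have ne : n%:R^-1 <= e by rewrite -[e]invrK lef_pV2 ?posrE ?invr_gt0// ltW// truncnS_gt.
pose h i x := Num.max 0 (Num.min 1 (n%:R * f x - i%:R)).
have cnf i : continuous (fun x => n%:R * f x - i%:R).
  by move=> x; apply: cvgB; [apply: cvgMr; exact: cf|exact: cvg_cst].
have ch i : continuous (h i).
  move=> x; apply: (@continuous_max _ _ (fun=> 0) (fun x => Num.min 1 (n%:R * f x - i%:R))).
    exact: cvg_cst.
  apply: (@continuous_min _ _ (fun=> 1) (fun x => n%:R * f x - i%:R)); first exact: cvg_cst.
  exact: cnf.
have h0 i x : 0 <= h i x by rewrite le_max lexx.
have h1 i x : h i x <= 1 by rewrite ge_max ler01 ge_min lexx.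
have sumh x : \sum_(i < n) h i x = n%:R * f x.
  by rewrite sum_clamp ?mulr_ge0// min_l// ler_piMr.
have hI i : I (h i.+1) <= L (h i).
  pose A := [set x | 1 < n%:R * f x - i%:R].
  have oA : open A.
    by have /continuousP/(_ _ (@open_gt _ 1)) := cnf i.
  apply: (@le_trans _ _ (fine (riesz_measure A))).
    apply: (Rintegral_le_measure cX); [exact: ch|exact: open_borel_measurable|].
    move=> x; rewrite indicE; case: (boolP (x \in A)) => [_|]; first exact: h1.
    rewrite notin_setE /A /= => /negP; rewrite -leNgt => xA.
    by rewrite ge_max lexx/= ge_min -natr1; apply/orP; right; lra.
  rewrite -lee_fin fineK ?riesz_outer_fin_num//.
  apply: riesz_outer_le_fun => // x; rewrite /A/= => xA.
  by rewrite le_max le_min lexx (ltW xA) orbT.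
have : \sum_(i < n) I (h i.+1) <= \sum_(i < n) L (h i) by exact: ler_sum.
have <- : L (fun x => \sum_(i < n) h i x) = \sum_(i < n) L (h i) by rewrite L_sum.
under [in X in _ <= L X]eq_fun do rewrite sumh.
rewrite LZ//.
(* Shifting the layers by one lowers [n * I f] by at most 1; after division by [n] the error is at
   most [n^-1 <= e]. *)
have -> : \sum_(i < n) I (h i.+1) = n%:R * I f - I (h 0) + I (h n).
  have -> : n%:R * I f = \sum_(i < n) I (h i).
    rewrite -(Rintegral_contZ cX)//; under eq_Rintegral do rewrite -sumh.
    by rewrite (Rintegral_cont_sum cX).
  have := telescope_sumr (fun i => I (h i)) (leq0n n).
  rewrite big_mkord sumrB => tele.
  by rewrite -addrA [- _ + _]addrC -tele addrC subrK.
have I0 : I (h 0) <= 1.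
  rewrite -[leRHS](Rintegral1 riesz_measure 1); apply: (le_Rintegral_cont cX) => //.
  exact: cst_continuous.
have In : 0 <= I (h n) by apply: Rintegral_ge0 => x _; exact: h0.
move=> hle; rewrite -(ler_pM2l n0) mulrDr.
have ne1 : 1 <= n%:R * e by rewrite -ler_pdivrMl// mulr1.
move: (I f) (I (h 0)) (I (h n)) I0 In hle => a b c b1 c0 hle.
by move: (n%:R * a) (n%:R * L f) (n%:R * e) hle ne1 => u v w; lra.
Qed.

(** The inequality for [h] and for [1 - h] gives equality when [0 <= h <= 1]; an affine rescaling by
    a bound [M] of [f] reduces to this case. *)
Lemma riesz_measure_integral (f : X -> R) : continuous f -> I f = L f.
Proof.
move=> cf; have [M M0 fM] := continuous_bound cX cf.
have unit_eq (h : X -> R) : continuous h -> (forall x, 0 <= h x) ->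
    (forall x, h x <= 1) -> I h = L h.
  move=> ch h0 h1; apply/eqP; rewrite eq_le riesz_measure_integral_le//=.
  have c1 : continuous (fun _ : X => 1 : R) by exact: cst_continuous.
  have : I (fun x => 1 - h x) <= L (fun x => 1 - h x).
    apply: riesz_measure_integral_le => [x|x|x].
    - by apply: cvgB; [exact: cvg_cst|exact: ch].
    - by rewrite subr_ge0.
    - by rewrite gerBl.
  by rewrite (Rintegral_contB cX)// LB// Rintegral1 L_cst lerD2l lerN2.
pose h x := (2 * M)^-1 * (f x + M).
have M20 : 0 < 2 * M by rewrite mulr_gt0.
have cM : continuous (fun _ : X => M) by exact: cst_continuous.
have cfM : continuous (fun x => f x + M).
  by move=> x; apply: cvgD; [exact: cf|exact: cvg_cst].
have : I h = L h.
  apply: unit_eq => [x|x|x]; first by apply: cvgMr; exact: cfM.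
    have := fM x; rewrite ler_norml => /andP[fM1 _].
    by rewrite mulr_ge0 ?invr_ge0 ?(ltW M20)//; lra.
  have := fM x; rewrite ler_norml => /andP[_ fM2].
  rewrite ler_pdivrMl//; lra.
rewrite (Rintegral_contZ cX)// LZ// (Rintegral_contD cX)// LD// Rintegral1 L_cst.
by move=> /(mulfI (invr_neq0 (lt0r_neq0 M20)))/addIr.
Qed.

(** Composing a cover of [A] with [T] gives a cover of the preimage with the same [L]-sum, so
    preimages do not gain mass; the same for the complement gives equality. *)
Lemma riesz_measure_invariant (T : X -> X) : continuous T ->
  (forall f : X -> R, continuous f -> L (f \o T) = L f) -> Defs.invariant T riesz_measure.
Proof.
move=> cT LT.
have le_T A : (riesz_measure (T @^-1` A) <= riesz_measure A)%E.
  apply/lee_addgt0Pr => e e0; have [f [cf f0 fA] fe] := riesz_cover_adherent A e0.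
  apply: le_trans fe; under eq_eseriesr do rewrite -LT//.
  apply: (@riesz_outer_le _ (fun m => f m \o T)); split => [m x|m x|x Ax].
  - by apply: continuous_comp; [exact: cT|exact: cf].
  - exact: f0.
  - exact: (fA (T x)).
move=> A mA; apply/eqP; rewrite eq_le le_T/=.
have mTA := continuous_preimage_borel cT mA.
have key (a b : \bar R) : a \is a fin_num -> b \is a fin_num ->
    (1 - a <= 1 - b)%E -> (b <= a)%E.
  case: a b => [a| |] [b| |] // _ _.
  by rewrite -[1%E]/(1%:E) -!EFinB !lee_fin lerD2l lerN2.
apply: key; [exact: riesz_outer_fin_num|exact: riesz_outer_fin_num|].
rewrite -(probability_setC riesz_measure mA) -(probability_setC riesz_measure mTA).
exact: le_T (~` A).
Qed.

Lemma riesz_representation : exists2 mu : probability (borel X) R,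
  forall f : X -> R, continuous f -> Rintegral mu setT f = L f &
  forall T : X -> X, continuous T ->
    (forall f : X -> R, continuous f -> L (f \o T) = L f) -> Defs.invariant T mu.
Proof.
exists (riesz_measure : probability (borel X) R).
  exact: riesz_measure_integral.
exact: riesz_measure_invariant.
Qed.

End Riesz.

(** * Empirical means and their ultralimits *)

Section Empirical.
Context {R : realType} {X : pmetricType R}.
Implicit Types (f : X -> R) (y : nat -> X).

(** Taken along an arbitrary sequence, so that it also applies to the shifted orbit [y \o S]. *)
Definition empirical y (n : nat) f : R := n%:R^-1 * \sum_(j < n) f (y j).

Lemma empirical_bound y n f M : 0 <= M -> (forall x, `|f x| <= M) ->
  `|empirical y n f| <= M.
Proof.
move=> M0 fM; rewrite /empirical; case: n => [|n].
  by rewrite invr0 mul0r normr0.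
rewrite normrM gtr0_norm ?invr_gt0// ler_pdivrMl//.
apply: (le_trans (ler_norm_sum _ _ _)).
apply: (@le_trans _ _ (\sum_(j < n.+1) M)); first exact: ler_sum.
by rewrite sumr_const card_ord mulr_natl.
Qed.

(** The difference telescopes to [(f (y 0) - f (y n)) / n]. *)
Lemma empirical_shift_cvg y f M : (forall x, `|f x| <= M) ->
  (fun n => empirical y n f - empirical (y \o S) n f) @ \oo --> (0 : R).
Proof.
move=> fM; have M0 : 0 <= M by exact: le_trans (fM point).
have -> : (fun n => empirical y n f - empirical (y \o S) n f) =
    (fun n => n%:R^-1 * (f (y 0%N) - f (y n))).
  apply/funext => n; rewrite /empirical -mulrBr; congr (_ * _).
  have := telescope_sumr (fun i => f (y i)) (leq0n n).
  by rewrite big_mkord sumrB /= => /(congr1 -%R); rewrite !opprB.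
apply/cvgrPdist_le => e e0; near=> n.
rewrite sub0r normrN normrM.
have n0 : 0 < n%:R :> R by rewrite ltr0n; near: n; exact: nbhs_infty_gt.
rewrite gtr0_norm ?invr_gt0// ler_pdivrMl//.
apply: (@le_trans _ _ (M + M)).
  by apply: (le_trans (ler_normB _ _)); exact: lerD.
rewrite -ler_pdivrMr// (le_trans (ltW (truncnS_gt _)))// ler_nat.
by near: n; exact: nbhs_infty_ge.
Unshelve. all: by end_near. Qed.

(** Compactness of [[- M, M]] gives a cluster point, which for an ultrafilter is a limit. One
    ultrafilter thus makes the means of all continuous functions converge at once, with no
    extraction of subsequences. *)
Lemma ultra_cvg_bounded (F : set_system nat) (u : nat -> R) (M : R) :
  UltraFilter F -> (forall n, `|u n| <= M) -> cvg (u @ F).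
Proof.
move=> FU uM.
have [|p [_ pF]] := @segment_compact R (- M) M (u @ F) _.
  by apply: (@filterE _ F) => n /=; rewrite in_itv/= -ler_norml.
apply/cvg_ex; exists p => A Ap.
have [//|FnA] := in_ultra_setVsetC (u @^-1` A) FU.
by have [q []] := pF (~` A) A FnA Ap.
Qed.

Variable T : X -> X.
Hypotheses (cX : compact [set: X]) (cT : continuous T).

Lemma empirical_ultralimit (F : set_system nat) x : UltraFilter F -> \oo `<=` F ->
  exists2 mu : probability (borel X) R, Defs.invariant T mu &
    forall f, continuous f ->
      empirical (fun j => iter j T x) n f @[n --> F] --> Rintegral mu setT f.
Proof.
move=> FU ooF; pose emp := empirical (fun j => iter j T x).
pose L f := lim (emp n f @[n --> F]).
have cvgL f : continuous f -> emp n f @[n --> F] --> L f.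
  move=> cf; have [M M0 fM] := continuous_bound cX cf.
  apply: (@ultra_cvg_bounded F (fun n => emp n f) M) => n.
  exact: empirical_bound (ltW M0) fM.
have limL f l : emp n f @[n --> F] --> l -> L f = l.
  by move=> /cvg_lim; apply.
have L1 : L (fun=> 1) = 1.
  (* The mean of 1 is 1 only for [n > 0], the empty mean being 0; this is eventually the case, hence
     also along [F]. *)
  apply: limL; apply: (@cvg_trans _ ((fun=> 1 : R) @ F)); last exact: cvg_cst.
  apply: near_eq_cvg; apply: ooF; near=> n.
  rewrite /emp /empirical sumr_const card_ord -[1 *+ n]/(n%:R) mulVf//.
  by rewrite pnatr_eq0 -lt0n; near: n; exact: nbhs_infty_gt.
have LD f g : continuous f -> continuous g -> L (fun x => f x + g x) = L f + L g.
  move=> cf cg; apply: limL.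
  rewrite (_ : (fun n => _) = fun n => emp n f + emp n g); last first.
    by apply/funext => n; rewrite /emp /empirical big_split mulrDr.
  by apply: cvgD; exact: cvgL.
have LZ c f : continuous f -> L (fun x => c * f x) = c * L f.
  move=> cf; apply: limL.
  rewrite (_ : (fun n => _) = fun n => c * emp n f); last first.
    by apply/funext => n; rewrite /emp /empirical -mulr_sumr mulrCA.
  by apply: cvgMr; exact: cvgL.
have L0 f : continuous f -> (forall x, 0 <= f x) -> 0 <= L f.
  move=> cf f0; apply: limr_ge; first by apply/cvg_ex; exists (L f); exact: cvgL.
  apply: filterE => n; rewrite /emp /empirical mulr_ge0 ?invr_ge0//.
  exact: sumr_ge0.
have [mu muL muT] := riesz_representation cX L1 LD LZ L0.
exists mu => [|f cf]; last by rewrite muL//; exact: cvgL.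
apply: muT => // f cf; apply: limL.
have [M M0 fM] := continuous_bound cX cf.
(* The means along the orbits of [x] and of [T x] have the same limit, which makes [L] invariant. *)
have shift0 := empirical_shift_cvg (fun j => iter j T x) fM.
have {}shift0 : emp n f - empirical ((fun j => iter j T x) \o S) n f @[n --> F] --> (0 : R).
  by move=> A /shift0/ooF.
rewrite (_ : (fun n => _) = fun n => emp n f - (emp n f - empirical ((fun j => iter j T x) \o S) n f)); last first.
  by apply/funext => n; rewrite opprB addrC subrK.
by rewrite -[L f]subr0; apply: cvgB => //; exact: cvgL.
Unshelve. all: by end_near. Qed.

End Empirical.

(** * V-statistics *)

Section Unlift.
Variables (n r : nat).

Let cons_ffun (p : 'I_n * {ffun 'I_r -> 'I_n}) : {ffun 'I_r.+1 -> 'I_n} :=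
  [ffun k => oapp p.2 p.1 (unlift ord0 k)].

Lemma big_ffun_recl (V : nmodType) (G : ('I_r.+1 -> 'I_n) -> V) :
  \sum_(i : {ffun 'I_r.+1 -> 'I_n}) G i =
  \sum_(a < n) \sum_(i : {ffun 'I_r -> 'I_n})
     G (fun k => oapp i a (unlift ord0 k)).
Proof.
rewrite pair_big/= (reindex cons_ffun)/=.
  by apply: eq_bigr => p _; congr G; apply/funext => k; rewrite ffunE.
exists (fun i : {ffun 'I_r.+1 -> 'I_n} => (i ord0, [ffun j => i (lift ord0 j)])) => /=.
  move=> [a i] _; rewrite ffunE unlift_none/=; congr pair.
  by apply/ffunP => j; rewrite !ffunE liftK.
move=> i _; apply/ffunP => k; rewrite ffunE/=.
by case: unliftP => [j ->|->] /=; rewrite ?ffunE.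
Qed.

End Unlift.

Lemma ptws_continuous {Y V : topologicalType} {I : Type} (f : Y -> {ptws I -> V}) :
  (forall i, continuous (fun y => f y i)) -> continuous f.
Proof.
move=> cf y; apply/cvg_sup => i U [W [[A oA <-] Afy] AU].
by apply: (filterS AU); exact: (cf i y A (open_nbhs_nbhs (conj oA Afy))).
Qed.

(** Near each [z0], joint continuity at [(z0, x)] gives the bound on a product neighbourhood, by
    comparing both values with [G (z0, x)]; compactness of [Y] makes the neighbourhood of [x]
    uniform. *)
Lemma compact_equicontinuous {R : realType} {Y Z : topologicalType} (G : Y * Z -> R)
    (x : Z) e : compact [set: Y] -> continuous G -> 0 < e ->
  \forall x' \near x, forall z, `|G (z, x) - G (z, x')| <= e.
Proof.
move=> /compact_near_coveringP nY cG e0; have e20 : 0 < e / 2 by rewrite divr_gt0.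
suff : \forall x' \near x, [set: Y] `<=` (fun z => `|G (z, x) - G (z, x')| <= e).
  by apply: filterS => x' gxx' z; exact: gxx'.
apply: (nY Z (nbhs x) (fun x' z => `|G (z, x) - G (z, x')| <= e)) => z _.
have /cvgrPdist_le/(_ _ e20)[[A B] /= [Az Bx] AB] := cG (z, x).
exists (A, B) => // -[z' x'] [/= Az' Bx'].
have h1 := AB (z', x') (conj Az' Bx').
have h2 := AB (z', x) (conj Az' (nbhs_singleton Bx)).
rewrite /= in h1 h2; rewrite [e]splitr.
apply: le_trans (lerD h2 h1); rewrite [in leRHS]distrC.
by apply: le_trans (ler_normD _ _); rewrite addrA subrK.
Qed.

Lemma continuous_section {Y Z V : topologicalType} (G : Y * Z -> V) (x : Z) :
  continuous G -> continuous (fun z => G (z, x)).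
Proof.
move=> cG z; apply: (@cvg_comp _ _ _ (fun z => (z, x)) G _ (nbhs (z, x))); last exact: cG.
by apply: cvg_pair; [exact: cvg_id|exact: cvg_cst].
Qed.

Section VStatistics.
Context {R : realType} {X : pmetricType R}.
Hypothesis cX : compact [set: X].

Definition vmean r (y : nat -> X) (n : nat) (g : ('I_r -> X) -> R) : R :=
  (n%:R ^+ r)^-1 * \sum_(i : {ffun 'I_r -> 'I_n}) g (fun k => y (i k)).

Lemma vmean0 y n (g : ('I_0 -> X) -> R) : vmean y n g = g (fun=> point).
Proof.
rewrite /vmean expr0 invr1 mul1r (eq_bigr (fun=> g (fun=> point))).
  by rewrite sumr_const card_ffun !card_ord expn0.
by move=> i _; congr g; apply/funext => -[].
Qed.

(** Splitting off the first index matches the recursion of [prod_integral], so that limits can be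
    taken one variable at a time. *)
Lemma vmeanS r y n (g : ('I_r.+1 -> X) -> R) :
  vmean y n g = empirical y n (fun x => vmean y n (fun z => g (ocons x z))).
Proof.
rewrite /vmean /empirical -mulr_sumr mulrA exprS invfM; congr (_ * _).
rewrite (big_ffun_recl (fun i => g (fun k => y (i k)))).
apply: eq_bigr => a _; apply: eq_bigr => i _; congr g; apply/funext => k.
by rewrite /ocons; case: unlift.
Qed.

Lemma vmean_dist r y n (g g' : ('I_r -> X) -> R) e : 0 <= e ->
  (forall z, `|g z - g' z| <= e) -> `|vmean y n g - vmean y n g'| <= e.
Proof.
elim: r g g' => [|r IHr] g g' e0 gg'; first by rewrite !vmean0.
rewrite !vmeanS.
have -> : empirical y n (fun x => vmean y n (fun z => g (ocons x z))) -
    empirical y n (fun x => vmean y n (fun z => g' (ocons x z))) =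
    empirical y n (fun x => vmean y n (fun z => g (ocons x z)) -
                            vmean y n (fun z => g' (ocons x z))).
  by rewrite /empirical -mulrBr -sumrB.
by apply: empirical_bound => // x; apply: IHr.
Qed.

Lemma ocons_continuous r :
  continuous (fun p : {ptws 'I_r -> X} * X => ocons p.2 p.1 : {ptws 'I_r.+1 -> X}).
Proof.
apply: ptws_continuous => k [z x]; rewrite /ocons.
case: (unlift ord0 k) => [j|]; last exact: cvg_snd.
apply: (@cvg_comp _ _ _ fst (fun f : {ptws 'I_r -> X} => f j) _ (nbhs z)).
  exact: cvg_fst.
exact: (@proj_continuous _ (fun=> X) j z).
Qed.

Lemma compact_ptws r : compact [set: {ptws 'I_r -> X}].
Proof.
have := @tychonoff 'I_r (fun=> X) (fun=> setT) (fun=> cX).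
by congr compact; apply/seteqP; split.
Qed.

Lemma ocons_comp_continuous r (g : {ptws 'I_r.+1 -> X} -> R) : continuous g ->
  continuous (fun p : {ptws 'I_r -> X} * X => g (ocons p.2 p.1)).
Proof. by move=> cg p; exact: (continuous_comp (@ocons_continuous r p) (cg _)). Qed.

Lemma ocons_equicontinuous r (g : {ptws 'I_r.+1 -> X} -> R) (x : X) e :
  continuous g -> 0 < e ->
  \forall x' \near x, forall z, `|g (ocons x z) - g (ocons x' z)| <= e.
Proof.
move=> /ocons_comp_continuous cG e0.
exact: (compact_equicontinuous x (@compact_ptws r) cG e0).
Qed.

Variables (mu : probability (borel X) R) (F : set_system nat) (y : nat -> X).
Hypotheses (FF : ProperFilter F).
Hypothesis empF : forall f : X -> R, continuous f ->
  empirical y n f @[n --> F] --> Rintegral mu setT f.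

(* The inner [r]-fold mean converges uniformly in the first variable [x], by
   equicontinuity and compactness, so it may be replaced by its limit, a
   continuous function of [x]. *)
Lemma vmean_cvg r (g : {ptws 'I_r -> X} -> R) : continuous g ->
  vmean y n g @[n --> F] --> prod_integral mu r g.
Proof.
elim: r g => [|r IHr] g cg.
  under eq_fun do rewrite vmean0; exact: cvg_cst.
have cgx x : continuous (fun z : {ptws 'I_r -> X} => g (ocons x z)).
  exact: continuous_section (ocons_comp_continuous cg).
pose G x := prod_integral mu r (fun z => g (ocons x z)).
have vG x : vmean y n (fun z => g (ocons x z)) @[n --> F] --> G x := IHr _ (cgx x).
(* The bound on the means passes to their limits, so [G] inherits continuity without any estimate of
   integrals. *)
have Gdist x x' e : 0 < e -> (forall z, `|g (ocons x z) - g (ocons x' z)| <= e) ->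
    `|G x - G x'| <= e.
  move=> e0 gxx'.
  have vGG : `|vmean y n (fun z => g (ocons x z)) - vmean y n (fun z => g (ocons x' z))|
      @[n --> F] --> `|G x - G x'|.
    by apply: cvg_norm; apply: cvgB; exact: vG.
  rewrite -(cvg_lim _ vGG)//; apply: limr_le; first exact: cvgP vGG.
  by apply: filterE => n; apply: vmean_dist; [exact: ltW|].
have cG : continuous G.
  move=> x; apply/cvgrPdist_le => e e0.
  near=> x'; apply: Gdist => //; near: x'.
  exact: ocons_equicontinuous.
(* Three errors of [e / 3]: from [x'] to [x] in the means, convergence at [x], and from [x] back to
   [x'] in [G]. Compactness makes [n] uniform. *)
have unif e : 0 < e -> \forall n \near F, forall x,
    `|vmean y n (fun z => g (ocons x z)) - G x| <= e.
  move=> e0; have e30 : 0 < e / 3 by rewrite divr_gt0.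
  have /compact_near_coveringP nX := cX.
  suff : \forall n \near F, [set: X] `<=`
      (fun x => `|vmean y n (fun z => g (ocons x z)) - G x| <= e).
    by apply: filterS => n gn x; exact: gn.
  apply: (nX nat F (fun n x => `|vmean y n (fun z => g (ocons x z)) - G x| <= e)) => x _.
  exists ([set x' | forall z, `|g (ocons x z) - g (ocons x' z)| <= e / 3],
          [set n | `|G x - vmean y n (fun z => g (ocons x z))| <= e / 3]).
    split => /=; first exact: ocons_equicontinuous.
    by have /cvgrPdist_le := vG x; exact.
  move=> [x' n] [/= gxx' vn].
  have h1 := vmean_dist y n (ltW e30) gxx'.
  have h2 := Gdist x x' _ e30 gxx'.
  move: h1 h2 vn; rewrite !ler_norml => /andP[? ?] /andP[? ?] /andP[? ?].
  by apply/andP; split; lra.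
apply/cvgrPdist_le => e e0; have e20 : 0 < e / 2 by rewrite divr_gt0.
near=> n; rewrite vmeanS.
have h1 : `|Rintegral mu setT G - empirical y n G| <= e / 2.
  by near: n; move: (empF cG) => /cvgrPdist_le; exact.
have h2 : `|empirical y n (fun x => G x - vmean y n (fun z => g (ocons x z)))| <= e / 2.
  have hn : forall x, `|vmean y n (fun z => g (ocons x z)) - G x| <= e / 2.
    by near: n; exact: unif.
  by apply: empirical_bound => [|x]; [exact: ltW|rewrite distrC].
have h3 : empirical y n (fun x => G x - vmean y n (fun z => g (ocons x z))) =
   empirical y n G - empirical y n (fun x => vmean y n (fun z => g (ocons x z))).
  by rewrite /empirical -mulrBr -sumrB.
rewrite h3 in h2; rewrite [e]splitr.
by apply: le_trans (lerD h1 h2); apply: le_trans (ler_normD _ _); rewrite addrA subrK.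
Unshelve. all: by end_near. Qed.

End VStatistics.

(** * Continuity sets *)

Section MonotoneContinuity.
Context {R : realType}.

(* Nested intervals, each inside the interior of the previous one and carrying at
   most half of its variation. *)
Lemma nondecreasing_continuity_point (V : R -> R) (a b : R) :
  {homo V : x y / x <= y} -> a < b ->
  exists2 r, a < r < b & forall e, 0 < e ->
    exists2 d, 0 < d & V (r + d) - V (r - d) <= e.
Proof.
move=> ndV ab.
(* The variations over [[u, m]] and [[m, v]] add up to at most that over [I], so one of them is at
   most half of it; keeping [u] and [v] off the endpoints puts the limit point strictly inside every
   interval. *)
pose step (I : R * R) := let m := (I.1 + I.2) / 2 in
  let u := (I.1 + m) / 2 in let v := (m + I.2) / 2 in
  if V m - V u <= (V I.2 - V I.1) / 2 then (u, m) else (m, v).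
have stepP I : I.1 < I.2 -> [/\ I.1 < (step I).1, (step I).1 < (step I).2,
    (step I).2 < I.2 & V (step I).2 - V (step I).1 <= (V I.2 - V I.1) / 2].
  move=> I12; rewrite /step; set m := (I.1 + I.2) / 2.
  set u := (I.1 + m) / 2; set v := (m + I.2) / 2.
  have um : u < m by rewrite /u /m; lra.
  have mv : m < v by rewrite /v /m; lra.
  have Iu : I.1 < u by rewrite /u /m; lra.
  have vI : v < I.2 by rewrite /v /m; lra.
  case: ifPn => /= [?|]; first by split => //; lra.
  rewrite -ltNge => h; split => //; first by lra.
  have := ndV _ _ (ltW Iu); have := ndV _ _ (ltW vI); lra.
pose s n := iter n step (a, b).
have s12 n : (s n).1 < (s n).2.
  by elim: n => [//|n IHn]; have [] := stepP _ IHn.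
have sS n : [/\ (s n).1 < (s n.+1).1, (s n.+1).2 < (s n).2 &
   V (s n.+1).2 - V (s n.+1).1 <= (V (s n).2 - V (s n).1) / 2].
  by have [] := stepP _ (s12 n).
have s1 : {homo (fun n => (s n).1) : n m / (n <= m)%N >-> n <= m}.
  by apply: homo_leq => [//|x y z|n]; [exact: le_trans|have [/ltW] := sS n].
have s2 n m : (n <= m)%N -> (s m).2 <= (s n).2.
  elim: m => [|m IHm]; first by rewrite leqn0 => /eqP ->.
  rewrite leq_eqVlt => /predU1P[->//|]; rewrite ltnS => /IHm; apply: le_trans.
  by have [_ /ltW] := sS m.
pose r := sup [set (s n).1 | n in setT].
have sub m : ubound [set (s n).1 | n in setT] (s m).2.
  move=> _ [n _ <-]; apply: (le_trans (s1 _ _ (leq_maxl n m))).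
  by apply: (le_trans (ltW (s12 _))); apply: s2; exact: leq_maxr.
have s1r n : (s n).1 <= r.
  by apply: ub_le_sup; [exists (s 0%N).2; exact: sub|exists n].
have rs2 n : r <= (s n).2 by apply: ge_sup; [exists (s 0%N).1, 0%N|exact: sub].
have s1r' n : (s n).1 < r by have [h _ _] := sS n; exact: lt_le_trans h (s1r _).
have rs2' n : r < (s n).2 by have [_ h _] := sS n; exact: le_lt_trans (rs2 _) h.
exists r; first by rewrite (s1r' 0%N) (rs2' 0%N).
move=> e e0; set D := V b - V a.
have Ds n : V (s n).2 - V (s n).1 <= D / 2 ^+ n.
  elim: n => [|n IHn]; first by rewrite expr0 divr1.
  have [_ _ /le_trans] := sS n; apply.
  by rewrite exprSr invfM mulrA ler_pM2r// invr_gt0.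
have [n Dn] : exists n, D / 2 ^+ n <= e.
  exists (Num.truncn (D / e)).+1; rewrite ler_pdivrMr ?exprn_gt0// mulrC -ler_pdivrMr//.
  apply: (le_trans (ltW (truncnS_gt _))).
  by rewrite -natrX ler_nat ltnW// ltn_expl.
exists (Num.min (r - (s n).1) ((s n).2 - r)).
  by rewrite lt_min !subr_gt0 s1r' rs2'.
set d := Num.min _ _.
have d1 : d <= r - (s n).1 by rewrite ge_min lexx.
have d2 : d <= (s n).2 - r by rewrite ge_min lexx orbT.
apply: le_trans Dn; apply: le_trans (Ds n).
by apply: lerB; apply: ndV; lra.
Qed.

End MonotoneContinuity.

(** * Sets with null boundary and their frequencies *)

Section RiemannSets.
Context {R : realType} {X : pmetricType R}.
Hypothesis cX : compact [set: X].
Variable mu : probability (borel X) R.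
Local Notation I := (Rintegral mu setT).

(** A functional form of having a [mu]-null boundary, convenient for stability under complements,
    intersections and preimages. *)
Definition riemann_set (A : set X) := forall e : R, 0 < e ->
  exists f g : X -> R, [/\ continuous f /\ continuous g,
    forall x, 0 <= f x <= \1_A x, forall x, \1_A x <= g x <= 1 & I g - I f <= e].

Lemma riemann_setT : riemann_set setT.
Proof.
move=> e e0; exists (fun=> 1), (fun=> 1); split.
- by split; exact: cst_continuous.
- by move=> x; rewrite indicT ler01 lexx.
- by move=> x; rewrite indicT lexx.
- by rewrite subrr ltW.
Qed.

Lemma riemann_setC A : riemann_set A -> riemann_set (~` A).
Proof.
move=> rA e /rA[f [g [[cf cg] fA gA fg]]].
have c1 : continuous (fun _ : X => 1 : R) by exact: cst_continuous.
exists (fun x => 1 - g x), (fun x => 1 - f x); split.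
- by split => x; apply: cvgB; [exact: c1|exact: cg|exact: c1|exact: cf].
- move=> x; have := gA x; have := fA x; rewrite !indicE in_setC.
  by case: (x \in A) => /=; lra.
- move=> x; have := gA x; have := fA x; rewrite !indicE in_setC.
  by case: (x \in A) => /=; lra.
- by rewrite !(Rintegral_contB cX)//; lra.
Qed.

Lemma riemann_setI A B : riemann_set A -> riemann_set B -> riemann_set (A `&` B).
Proof.
move=> rA rB e e0; have e20 : 0 < e / 2 by rewrite divr_gt0.
have [f [g [[cf cg] fA gA fg]]] := rA _ e20.
have [f' [g' [[cf' cg'] fB gB fg']]] := rB _ e20.
have cff' : continuous (fun x => f x * f' x).
  by move=> x; apply: cvgM; [exact: cf|exact: cf'].
have cgg' : continuous (fun x => g x * g' x).
  by move=> x; apply: cvgM; [exact: cg|exact: cg'].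
have le01 (C : set X) x : (0 <= \1_C x :> R) /\ (\1_C x <= 1 :> R).
  by rewrite indicE; case: (x \in C).
have indM x : \1_(A `&` B) x = \1_A x * \1_B x :> R.
  by rewrite !indicE in_setI; case: (x \in A); case: (x \in B); rewrite ?mulr0 ?mul0r ?mulr1.
exists (fun x => f x * f' x), (fun x => g x * g' x); split => //.
- move=> x; rewrite indM; have /andP[? ?] := fA x; have /andP[? ?] := fB x.
  by rewrite mulr_ge0// ler_pM.
- move=> x; rewrite indM; have /andP[a1 a2] := gA x; have /andP[b1 b2] := gB x.
  have [iA _] := le01 A x; have [iB _] := le01 B x.
  rewrite ler_pM//= mulr_ile1//; [exact: le_trans iA a1|exact: le_trans iB b1].
(* Since [g] and [f'] are at most 1, [g * g' - f * f' = g * (g' - f') + f' * (g - f)] is at most the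
   sum of the two gaps. *)
- have : I (fun x => g x * g' x) - I (fun x => f x * f' x) <=
      I (fun x => (g x - f x) + (g' x - f' x)).
    rewrite -(Rintegral_contB cX)//; apply: (le_Rintegral_cont cX).
    + by move=> x; apply: cvgB; [exact: cgg'|exact: cff'].
    + by move=> x; apply: cvgD; apply: cvgB; [exact: cg|exact: cf|exact: cg'|exact: cf'].
    + move=> x; have /andP[? ?] := fA x; have /andP[? ?] := fB x.
      have /andP[? ?] := gA x; have /andP[? ?] := gB x.
      have [? ?] := le01 A x; have [? ?] := le01 B x; nra.
  have cgf : continuous (fun x => g x - f x) by move=> x; apply: cvgB; [exact: cg|exact: cf].
  have cgf' : continuous (fun x => g' x - f' x) by move=> x; apply: cvgB; [exact: cg'|exact: cf'].
  rewrite (Rintegral_contD cX)// !(Rintegral_contB cX)//.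
  move: (I _) (I _) fg fg' => *; lra.
Qed.

Lemma riemann_preimage (T : X -> X) A : continuous T ->
  (forall f, continuous f -> I (f \o T) = I f) ->
  riemann_set A -> riemann_set (T @^-1` A).
Proof.
move=> cT IT rA e /rA[f [g [[cf cg] fA gA fg]]].
exists (f \o T), (g \o T); split.
- by split => x; apply: continuous_comp => //; [exact: cT|exact: cf|exact: cT|exact: cg].
- by move=> x; exact: (fA (T x)).
- by move=> x; exact: (gA (T x)).
- by rewrite !IT.
Qed.

Lemma riemann_ball (p : X) (r : R) :
  (forall e, 0 < e -> exists2 d, 0 < d &
     fine (mu [set x | mdist p x < r + d]) - fine (mu [set x | mdist p x < r - d]) <= e) ->
  riemann_set [set x | mdist p x < r].
Proof.
move=> rP e /rP[d d0 rd].
(* A ramp of width [d] between the indicators of the balls of radii [t - d] and [t]; [t = r] and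
   [t = r + d] sandwich the ball of radius [r]. *)
pose f t x := Num.max 0 (Num.min 1 ((t - mdist p x) / d)).
have cf t : continuous (f t).
  move=> x; apply: (@continuous_max _ _ (fun=> 0) (fun x => Num.min 1 ((t - mdist p x) / d))).
    exact: cvg_cst.
  apply: (@continuous_min _ _ (fun=> 1) (fun x => (t - mdist p x) / d)).
    exact: cvg_cst.
  by apply: cvgMl; apply: cvgB; [exact: cvg_cst|exact: mdist_continuous].
have f0 t x : 0 <= f t x by rewrite le_max lexx.
have f1 t x : f t x <= 1 by rewrite ge_max ler01 ge_min lexx.
have fle t x : f t x <= \1_[set x | mdist p x < t] x.
  rewrite indicE; case: (boolP (x \in _)) => [_|]; first exact: f1.
  rewrite notin_setE /= => /negP; rewrite -leNgt => xt.
  rewrite ge_max lexx/= ge_min; apply/orP; right.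
  by rewrite pmulr_lle0 ?invr_gt0// subr_le0.
have gef t x : \1_[set x | mdist p x < t - d] x <= f t x.
  rewrite indicE; case: (boolP (x \in _)) => [|_]; last exact: f0.
  rewrite inE /= => xt; rewrite le_max le_min lexx/= ler_pdivlMr//.
  by apply/orP; right; lra.
have mball t : measurable ([set x | mdist p x < t] : set (borel X)).
  apply: open_borel_measurable.
  by have /continuousP/(_ _ (@open_lt _ t)) := @mdist_continuous R X p.
exists (f r), (f (r + d)); split => //.
- by move=> x; rewrite f0 fle.
- by move=> x; rewrite f1 andbT; have := gef (r + d) x; rewrite addrK.
- apply: le_trans rd; apply: lerB.
    exact: (Rintegral_le_measure cX).
  exact: (measure_le_Rintegral cX).
Qed.

(** The portmanteau argument: the means of the indicator lie between those of two continuous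
    functions with nearly equal integrals. *)
Lemma riemann_empirical (F : set_system nat) (y : nat -> X) (A : set X) :
  ProperFilter F ->
  (forall f, continuous f -> empirical y n f @[n --> F] --> I f) ->
  measurable (A : set (borel X)) -> riemann_set A ->
  empirical y n \1_A @[n --> F] --> fine (mu A).
Proof.
move=> FF yI mA rA; apply/cvgrPdist_le => e e0; have e20 : 0 < e / 2 by rewrite divr_gt0.
have [f [g [[cf cg] fA gA fg]]] := rA _ e20.
have Af : I f <= fine (mu A).
  by apply: (Rintegral_le_measure cX) => // x; case/andP: (fA x).
have Ag : fine (mu A) <= I g.
  by apply: (measure_le_Rintegral cX) => // x; case/andP: (gA x).
have emp_le (h k : X -> R) n : (forall x, h x <= k x) -> empirical y n h <= empirical y n k.
  by move=> hk; rewrite ler_wpM2l ?invr_ge0//; apply: ler_sum.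
near=> n.
have nf : `|I f - empirical y n f| <= e / 2.
  by near: n; have /cvgrPdist_le := yI f cf; exact.
have ng : `|I g - empirical y n g| <= e / 2.
  by near: n; have /cvgrPdist_le := yI g cg; exact.
have fA' : empirical y n f <= empirical y n \1_A by apply: emp_le => x; case/andP: (fA x).
have gA' : empirical y n \1_A <= empirical y n g by apply: emp_le => x; case/andP: (gA x).
move: nf ng; rewrite !ler_norml => /andP[? ?] /andP[? ?].
by apply/andP; split; lra.
Unshelve. all: by end_near. Qed.

End RiemannSets.

(** * Coding an orbit *)

Section Cylinders.
Context {R : realType} {X : pmetricType R} (T : X -> X).
Hypothesis cT : continuous T.
Variables (k : nat) (P : 'I_k -> set (borel X)).
Hypothesis partP : is_partition P.

(** The atoms of the joins are indexed by words, so that their measures form a process to which the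
    block entropy lemmas apply; [cylinder_codom] links the two. *)
Fixpoint cylinder (w : seq 'I_k) : set (borel X) :=
  if w is a :: w' then P a `&` T @^-1` cylinder w' else setT.

Lemma cylinder_rcons w a : cylinder (rcons w a) = cylinder w `&` iter (size w) T @^-1` P a.
Proof.
elim: w => [|b w IHw] /=; first by rewrite setTI setIT.
rewrite IHw preimage_setI setIA; congr (_ `&` _).
by apply/seteqP; split => x; rewrite /preimage/= -iterS iterSr.
Qed.

Lemma cylinderP w x (a0 : 'I_k) :
  cylinder w x <-> forall i, (i < size w)%N -> P (nth a0 w i) (iter i T x).
Proof.
elim: w x => [|a w IHw] x; first by split.
split=> [[ax /IHw wx] [|i] //=|wx].
  by rewrite ltnS => /wx; rewrite -iterSr.
split; first exact: (wx 0%N).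
by apply/IHw => i iw; rewrite -iterSr; exact: (wx i.+1).
Qed.

Lemma cylinder_codom n (f : {ffun 'I_n -> 'I_k}) : join_atom T P f = cylinder (codom f).
Proof.
apply/seteqP; split => x; have [a0 _] := partP.2.2 x => fx.
  apply/(cylinderP _ _ a0) => i; rewrite size_codom card_ord => ik.
  by have := fx (Ordinal ik); rewrite -(nth_fgraph_ord a0).
move=> j; have /(cylinderP _ _ a0)/(_ j) := fx.
by rewrite size_codom card_ord ltn_ord codom_ffun nth_fgraph_ord; apply.
Qed.

Lemma cylinder_code w x (c : nat -> 'I_k) : (forall i, P (c i) (iter i T x)) ->
  cylinder w x <-> w = mkseq c (size w).
Proof.
move=> cx; split => [wx|wc].
  apply: (@eq_from_nth _ (c 0%N)); first by rewrite size_mkseq.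
  move=> i iw; rewrite nth_mkseq//; apply: contrapT => /eqP.
  move=> /(partP.2.1 (nth (c 0%N) w i) (c i)) PP.
  have : (P (nth (c 0%N) w i) `&` P (c i)) (iter i T x).
    by split => //; exact: (cylinderP w x (c 0%N)).1 wx i iw.
  by rewrite PP.
apply/(cylinderP _ _ (c 0%N)) => i iw.
by rewrite wc nth_mkseq.
Qed.

Lemma measurable_cylinder w : measurable (cylinder w).
Proof.
elim: w => [|a w IHw]; first exact: measurableT.
have mP := partP.1 a.
exact: measurableI mP (continuous_preimage_borel cT IHw).
Qed.

Lemma continuous_iter i : continuous (iter i T).
Proof.
elim: i => [|i IHi] x /=; first exact: cvg_id.
by apply: (@continuous_comp _ _ _ (iter i T) T); [exact: IHi|exact: cT].
Qed.

Variable mu : probability (borel X) R.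
Hypothesis muT : Defs.invariant T mu.

(** The map [g] is the identity when a letter is prepended and an iterate of [T] when one is
    appended. *)
Lemma sum_partition (A : set (borel X)) (g : X -> X) : continuous g -> measurable A ->
  \sum_a fine (mu (A `&` g @^-1` P a)) = fine (mu A).
Proof.
move=> cg mA.
have mAP a : measurable (A `&` g @^-1` P a : set (borel X)).
  by apply: measurableI => //; apply: continuous_preimage_borel => //; exact: partP.1.
apply: EFin_inj; rewrite -sumEFin fineK ?fin_num_measure//.
under eq_bigr => a _ do rewrite fineK ?fin_num_measure//.
rewrite -(@measure_bigsetU_ord _ _ _ mu k xpredT (fun a => A `&` g @^-1` P a))//.
  congr (mu _); rewrite -bigcup_seq; apply/seteqP; split => x.
    by move=> [i _] [].
  move=> Ax; have [a Pa] := partP.2.2 (g x); exists a => //.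
  by rewrite /= mem_index_enum.
apply/trivIsetP => a b _ _ /(partP.2.1) PP.
by rewrite setIACA setIid -preimage_setI PP preimage_set0 setI0.
Qed.

Lemma cylinder_measure_cons w :
  \sum_a fine (mu (cylinder (a :: w))) = fine (mu (cylinder w)).
Proof.
(* Prepending a letter moves the rest of the word by [T]; invariance compensates for this. *)
rewrite -(muT (measurable_cylinder w)).
have mTw : measurable (T @^-1` cylinder w : set (borel X)).
  by apply: continuous_preimage_borel => //; exact: measurable_cylinder.
rewrite -(@sum_partition _ id _ mTw); last by move=> x; exact: cvg_id.
by apply: eq_bigr => a _; rewrite /= setIC.
Qed.

Lemma cylinder_measure_rcons w :
  \sum_a fine (mu (cylinder (rcons w a))) = fine (mu (cylinder w)).
Proof.
under eq_bigr do rewrite cylinder_rcons.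
by apply: sum_partition; [exact: continuous_iter|exact: measurable_cylinder].
Qed.

Lemma join_entropyE n :
  join_entropy T mu P n = word_entropy (fun w => fine (mu (cylinder w))) n.
Proof.
rewrite /word_entropy -big_ffun_words; apply: eq_bigr => f _.
by rewrite cylinder_codom.
Qed.

Lemma cond_entropy_lt_mentropy (s : R) : (mentropy T mu < s%:E)%E ->
  exists j, cond_entropy (fun w => fine (mu (cylinder w))) j < s.
Proof.
move=> hs; apply: (@cond_entropy_lt R _ _ _ _ cylinder_measure_cons cylinder_measure_rcons).
- by move=> w; rewrite fine_ge0.
- exact: (congr1 fine (probability_setT mu)).
have : ((part_entropy T mu P)%:E < s%:E)%E.
  by apply: le_lt_trans hs; apply: ereal_sup_ubound; exists k, P.
rewrite lte_fin /part_entropy; under eq_fun do rewrite join_entropyE.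
by [].
Qed.

End Cylinders.

(** * Small partitions with null boundaries *)

Section SmallPartition.
Context {R : realType} {X : pmetricType R}.
Hypothesis cX : compact [set: X].

Lemma finite_net (d : R) : 0 < d ->
  exists k (p : 'I_k -> X), forall x, exists i, mdist (p i) x < d.
Proof.
move=> d0; have := cX; rewrite compact_cover.
move=> /(_ X setT (fun p => [set x | mdist p x < d])).
case=> [p _|x _|D _ XD].
- by have /continuousP/(_ _ (@open_lt _ d)) := @mdist_continuous R X p.
- by exists x => //=; rewrite mdistxx.
pose s := finmap.enum_fset D.
exists (size s), (fun i => nth point s i) => x.
have [p pD px] := XD x I.
have ps : (index p s < size s)%N by rewrite index_mem.
by exists (Ordinal ps); rewrite /= nth_index.
Qed.

Variables (k : nat) (p : 'I_k -> X).

Definition ball_partition (r : R) (i : 'I_k) : set X :=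
  [set x | mdist (p i) x < r] `&`
    \big[setI/setT]_(j < k | (j < i)%N) ~` [set x | mdist (p j) x < r].

Lemma ball_partitionP r i x : ball_partition r i x <->
  mdist (p i) x < r /\ forall j : 'I_k, (j < i)%N -> ~ (mdist (p j) x < r).
Proof.
rewrite /ball_partition -bigcap_seq_cond; split => -[xi xj]; split => // j.
  by move=> ji; apply: xj; rewrite /= mem_index_enum.
by move=> /= /andP[_]; exact: xj.
Qed.

(** Applied both to measurability and to [riemann_set]. *)
Lemma ball_partition_ind (Q : set X -> Prop) r : Q setT ->
  (forall A, Q A -> Q (~` A)) -> (forall A B, Q A -> Q B -> Q (A `&` B)) ->
  (forall i, Q [set x | mdist (p i) x < r]) -> forall i, Q (ball_partition r i).
Proof.
by move=> QT QC QI Qb i; apply: (QI _ _ (Qb i)); apply: (big_ind Q) => [//|A B|j _]; [exact: QI|exact: QC].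
Qed.

Lemma is_partition_ball (r : R) : (forall x, exists i, mdist (p i) x < r) ->
  is_partition (ball_partition r : 'I_k -> set (borel X)).
Proof.
move=> pr; split; first apply: ball_partition_ind.
- exact: measurableT.
- by move=> A; exact: measurableC.
- by move=> A B; exact: measurableI.
- move=> i; apply: open_borel_measurable.
  by have /continuousP/(_ _ (@open_lt _ r)) := @mdist_continuous R X (p i).
split=> [i j ij|x].
  apply/seteqP; split => // x [/ball_partitionP[xi xi'] /ball_partitionP[xj xj']].
  by case: (ltngtP i j) => [/xj'|/xi'|/val_inj ijE] //; rewrite ijE eqxx in ij.
have [i0 /asboolT xi0] := pr x.
have [i /asboolP xi imin] := @arg_minnP _ i0 (fun i => `[< mdist (p i) x < r >]) val xi0.
exists i; apply/ball_partitionP; split => // j ji xj.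
by have := imin j (asboolT xj); rewrite leqNgt ji.
Qed.

(** The radius is a continuity point of the sum, over all centers, of the measures of the balls.
    Each summand is nondecreasing, so it is continuous there too, and one radius serves all
    centers. *)
Lemma exists_riemann_radius (mu : probability (borel X) R) (d : R) : 0 < d ->
  exists2 r, d < r < 2 * d & forall i, riemann_set mu (ball_partition r i).
Proof.
move=> d0; pose v i r := fine (mu [set x | mdist (p i) x < r]).
have mball i t : measurable ([set x | mdist (p i) x < t] : set (borel X)).
  apply: open_borel_measurable.
  by have /continuousP/(_ _ (@open_lt _ t)) := @mdist_continuous R X (p i).
have ndv i : {homo v i : r s / r <= s}.
  move=> r s rs; apply: fine_le; rewrite ?fin_num_measure//.
  apply: le_measure; [apply/mem_set; exact: mball|apply/mem_set; exact: mball|].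
  by move=> x /= /lt_le_trans; apply.
pose V r := \sum_i v i r.
have ndV : {homo V : r s / r <= s}.
  by move=> r s rs; apply: ler_sum => i _; exact: ndv.
have d2 : d < 2 * d by rewrite mulr_natl mulr2n ltrDl.
have [r rd rP] := nondecreasing_continuity_point ndV d2.
exists r => //; apply: ball_partition_ind.
- exact: riemann_setT.
- exact: riemann_setC.
- exact: riemann_setI.
- move=> i; apply: (riemann_ball cX) => e /rP[t t0 Vt]; exists t => //.
  apply: le_trans Vt; rewrite /V -sumrB (bigD1 i)//= lerDl sumr_ge0// => j _.
  by rewrite subr_ge0 ndv//; lra.
Qed.

End SmallPartition.

Section Code.
Context {R : realType} {X : pmetricType R} (T : X -> X).
Hypotheses (cX : compact [set: X]) (cT : continuous T).
Variables (mu : probability (borel X) R) (F : set_system nat) (x : X).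
Hypotheses (FF : ProperFilter F) (ooF : \oo `<=` F) (muT : Defs.invariant T mu).
Hypothesis empF : forall f : X -> R, continuous f ->
  empirical (fun j => iter j T x) n f @[n --> F] --> Rintegral mu setT f.

(** Both integrals are limits along [F] of means that differ by a vanishing telescoped term. *)
Lemma invariant_integral (f : X -> R) : continuous f ->
  Rintegral mu setT (f \o T) = Rintegral mu setT f.
Proof.
move=> cf; have [M M0 fM] := continuous_bound cX cf.
have cfT : continuous (f \o T).
  by move=> z; apply: continuous_comp; [exact: cT|exact: cf].
pose dif n := empirical (fun j => iter j T x) n f -
  empirical (fun j => iter j T x) n (f \o T).
have h : dif n @[n --> F] --> Rintegral mu setT f - Rintegral mu setT (f \o T).
  by apply: cvgB; exact: empF.
have h0 : dif n @[n --> F] --> (0 : R).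
  by move=> A /(empirical_shift_cvg (fun j => iter j T x) fM)/ooF.
by apply/eqP; rewrite eq_sym -subr_eq0 -(cvg_lim _ h)// (cvg_lim _ h0).
Qed.

(* For large [n] along [F], the mean weight of the blocks of the code of [x]
   is close to the [mu]-average of the weights. *)
Lemma exists_code (k : nat) (p : 'I_k -> X) (d s : R) : 0 < d ->
  (forall z, exists i, mdist (p i) z < d) -> (mentropy T mu < s%:E)%E ->
  exists M j theta,
    (forall u : seq 'I_k, size u = j ->
       \sum_c expR (- code_weight M j theta u c : R) <= expR (M.+1%:R^-1)) /\
    exists c : nat -> 'I_k, (forall i, mdist (p (c i)) (iter i T x) < 2 * d) /\
      forall N, exists2 n, (N <= n)%N &
        \sum_(i < n) code_weight M j theta (mkseq (fun t => c (i.+1 + t)%N) j) (c i)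
          <= n%:R * (s - 2 / M.+1%:R).
Proof.
move=> d0 pd hs.
(* [r > d] keeps the balls covering [X], and [r < 2 * d] bounds the distance to the centers. *)
have [r /andP[dr rd] rP] := exists_riemann_radius cX p mu d0.
pose P : 'I_k -> set (borel X) := ball_partition p r.
have partP : is_partition P.
  by apply: is_partition_ball => z; have [i zi] := pd z; exists i; exact: lt_trans dr.
have [j hj] := cond_entropy_lt_mentropy cT partP muT hs.
have [M [theta [aM as_]]] := exists_code_weight (fun w => fine_ge0 (measure_ge0 mu _))
  (cylinder_measure_cons cT partP muT) (congr1 fine (probability_setT mu)) hj.
exists M, j, theta; split => //.
have /choice[c cP] : forall i, exists a, P a (iter i T x) by move=> i; exact: partP.2.2.
exists c; split.
  by move=> i; have [/= h _] := cP i; exact: lt_trans rd.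
move=> N; pose a := code_weight M j theta : seq 'I_k -> 'I_k -> R.
pose emp := empirical (fun j => iter j T x).
have riemann_cyl w : riemann_set mu (cylinder T P w).
  elim: w => [|b w IHw] /=; first exact: riemann_setT.
  apply: (riemann_setI cX); first exact: rP.
  by apply: riemann_preimage => // f; exact: invariant_integral.
(* The average weight read from the code at the first [n] times, written as a combination of
   cylinder frequencies. *)
pose mean n := \sum_(w <- words 'I_k j) \sum_b a w b * emp n \1_(cylinder T P (b :: w)).
have mean_cvg : mean n @[n --> F] -->
    \sum_(w <- words 'I_k j) \sum_b a w b * fine (mu (cylinder T P (b :: w))).
  apply: (cvg_big add_continuous) => w _; apply: (cvg_big add_continuous) => b _.
  apply: cvgMr.
  by apply: (riemann_empirical cX FF empF) => //; exact: (measurable_cylinder cT partP (b :: w)).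
have mean_lt : \forall n \near F, mean n < s - 2 / M.+1%:R.
  move/cvgr_lt : mean_cvg; apply; apply: le_lt_trans as_.
  apply: ler_sum => w _; apply: ler_sum => b _.
  by rewrite mulrC.
have [n [/= Nn hn]] : exists n, (N < n)%N /\ mean n < s - 2 / M.+1%:R.
  by apply: (@filter_ex _ F); apply: filterI mean_lt; apply: ooF; exists N.+1.
exists n; first exact: ltnW.
have n0 : 0 < n%:R :> R by rewrite ltr0n (leq_trans _ Nn).
rewrite -ler_pdivrMl//; apply: le_trans (ltW hn).
have -> : mean n = n%:R^-1 * \sum_(i < n) \sum_(w <- words 'I_k j) \sum_b
    a w b * \1_(cylinder T P (b :: w)) (iter i T x).
  rewrite [X in _ = _ * X]exchange_big/= mulr_sumr; apply: eq_bigr => w _.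
  rewrite exchange_big/= mulr_sumr; apply: eq_bigr => b _.
  by rewrite /emp /empirical mulrCA; congr (_ * _); rewrite mulr_sumr.
rewrite ler_pM2l ?invr_gt0//; apply: ler_sum => i _.
have c_code t : P (c (i + t)%N) (iter t T (iter i T x)) by rewrite -iterD addnC; exact: cP.
set w0 := mkseq _ j.
have w0j : w0 \in words 'I_k j by rewrite mem_words size_mkseq.
(* The only cylinder of length [j.+1] containing [iter i T x] is that of [c i :: w0], so the double
   sum collapses to the weight at time [i]. *)
have ind w b : size w = j -> \1_(cylinder T P (b :: w)) (iter i T x) = (w == w0)%:R * (b == c i)%:R :> R.
  move=> wj; rewrite indicE -natrM mulnb; congr (nat_of_bool _)%:R.
  have mk : mkseq (fun t => c (i + t)%N) (size (b :: w)) = c i :: w0.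
    rewrite /= wj /mkseq/= addn0; congr cons; rewrite /w0 /mkseq -[1%N]/(1 + 0)%N iotaDl -map_comp.
    by apply: eq_map => t /=; rewrite addnA addn1 addSn.
  have := cylinder_code partP (b :: w) c_code; rewrite mk => codeP.
  apply/idP/andP => [|[/eqP wE /eqP bE]].
    by move=> /set_mem/codeP[-> ->].
  by apply/mem_set/codeP; rewrite wE bE.
rewrite big_seq (eq_bigr (fun w => \sum_b a w b * ((w == w0)%:R * (b == c i)%:R))); last first.
  by move=> w; rewrite mem_words => /eqP wj; apply: eq_bigr => b _; rewrite ind.
rewrite -big_seq (bigD1_seq w0)//= ?uniq_words// [X in _ + X]big1 ?addr0; last first.
  by move=> w /negPf ->; apply: big1 => b _; rewrite mul0r mulr0.
rewrite (bigD1 (c i))//= [X in _ + X]big1 ?addr0; last first.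
  by move=> b /negPf ->; rewrite !mulr0.
by rewrite !eqxx !mulr1.
Qed.

End Code.

(** * The variational formula *)

Section UpperBound.
Context {R : realType} {X : pmetricType R} (T : X -> X).
Hypotheses (cX : compact [set: X]) (cT : continuous T).

Section CodedSet.
Variables (k : nat) (p : 'I_k -> X) (d s : R) (M j : nat) (theta : seq nat).

Let a : seq 'I_k -> 'I_k -> R := code_weight M j theta.

(** With [p], [d] and [s] fixed, only countably many data [M], [j], [theta] remain. The first
    condition does not involve [x]: it makes the set empty for weights that are too small, so the
    bound below holds for all data. *)
Definition coded_set : set X := [set x |
  (forall u : seq 'I_k, size u = j -> \sum_c expR (- a u c) <= expR (M.+1%:R^-1)) /\
  exists c : nat -> 'I_k, (forall i, mdist (p (c i)) (iter i T x) < 2 * d) /\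
    forall N, exists2 n, (N <= n)%N &
      \sum_(i < n) a (mkseq (fun t => c (i.+1 + t)%N) j) (c i)
        <= n%:R * (s - 2 / M.+1%:R)].

(** Some point whose orbit follows [w] within [2 * d], with [point] as the default when there is
    none. *)
Let center n (w : seq 'I_k) : X := xget point [set y | forall i (b : 'I_k), (i < n)%N ->
  mdist (p (nth b w i)) (iter i T y) < 2 * d].

Let good n (w : seq 'I_k) := expR (- (n%:R * (s - 2 / M.+1%:R))) <= word_weight j a w.

(** Markov's inequality for the total weight of words. The margin [2 / M.+1] exceeds the growth rate
    [1 / M.+1] of that total, which leaves geometric decay. *)
Let count_good n :
  (forall u : seq 'I_k, size u = j -> \sum_c expR (- a u c) <= expR (M.+1%:R^-1)) ->
  (count (good n) (words 'I_k (n + j)))%:R * expR (- s * n%:R) <=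
    (k ^ j)%:R * expR (- M.+1%:R^-1) ^+ n.
Proof.
move=> aM; set t := n%:R * (s - 2 / M.+1%:R).
have le_weight : (count (good n) (words 'I_k (n + j)))%:R * expR (- t) <=
    (k ^ j)%:R * expR (M.+1%:R^-1) ^+ n.
  apply: le_trans (_ : \sum_(w <- words 'I_k (n + j)) word_weight j a w <= _).
    rewrite -sum1_count natr_sum mulr_suml big_mkcond/=; apply: ler_sum => w _.
    case: ifPn => [gw|_]; first by rewrite mul1r.
    exact: word_weight_ge0.
  by have := sum_word_weight n (expR_ge0 _) aM; rewrite card_ord.
have := ler_wpM2r (expR_ge0 (t - s * n%:R)) le_weight.
rewrite -!mulrA -!expRM_natl -!expRD.
have -> : - t + (t - s * n%:R) = - s * n%:R by ring.
by have -> : n%:R * M.+1%:R^-1 + (t - s * n%:R) = n%:R * - M.+1%:R^-1 by rewrite /t; ring.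
Qed.

Lemma bowen_H_coded_set : bowen_H T s coded_set (4 * d) = 0%E.
Proof.
have [aM|aM] := pselect (forall u : seq 'I_k,
    size u = j -> \sum_c expR (- a u c) <= expR (M.+1%:R^-1)); last first.
  (* Here the coded set is empty, so empty lists of centers suffice. *)
  apply: (@bowen_H_limsup_eq0 _ _ _ _ _ _ (fun=> [::]) 1 (1 / 2)) => //.
  - lra.
  - by move=> n; rewrite mul0r mul1r exprn_ge0//; lra.
  - by move=> x [].
apply: (@bowen_H_limsup_eq0 _ _ _ _ _ _
    (fun n => [seq center n w | w <- words 'I_k (n + j) & good n w])
    (k ^ j)%:R (expR (- M.+1%:R^-1))) => //.
- by move=> n; rewrite size_map size_filter; exact: count_good.
move=> x [_ [c [cx cN]]] N; have [n Nn hn] := cN N.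
exists n => //; set w := mkseq c (n + j).
exists (center n w).
  apply: map_f; rewrite mem_filter mem_words size_mkseq eqxx andbT.
  by rewrite /good word_weight_code ler_expR lerN2.
have xw : [set y | forall i (b : 'I_k), (i < n)%N ->
    mdist (p (nth b w i)) (iter i T y) < 2 * d] x.
  by move=> i b ni; rewrite nth_mkseq// ltn_addr.
move=> i ni; have := @xgetPex _ point _ (ex_intro _ x xw) i (c 0%N) ni.
have := xw i (c 0%N) ni; rewrite -/(center n w).
(* Both orbits stay within [2 * d] of the same points of the net, hence the radius [4 * d]. *)
have := metric_triangle (iter i T (center n w)) (p (nth (c 0%N) w i)) (iter i T x).
rewrite (metric_sym (iter i T (center n w)) (p _)); lra.
Qed.

End CodedSet.

(** The measure may vary with the point: each point lies in one of countably many coded sets, and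
    [bowen_H] vanishes on all of them. *)
Lemma htop_le_ultralimit (E : set X) (S : \bar R) :
  (forall x, E x -> exists (F : set_system nat) (mu : probability (borel X) R),
    [/\ ProperFilter F, \oo `<=` F, Defs.invariant T mu,
      forall f : X -> R, continuous f ->
        empirical (fun j => iter j T x) n f @[n --> F] --> Rintegral mu setT f &
      (mentropy T mu <= S)%E]) ->
  (htop T E <= S)%E.
Proof.
move=> EF; apply: htop_le => s e Ss e0; pose d := e / 4.
have d0 : 0 < d by rewrite divr_gt0.
have -> : e = 4 * d by rewrite /d mulrCA divff ?mulr1// pnatr_eq0.
have [k [p pd]] := finite_net cX d0.
pose Z i := if unpickle i is Some (M, j, theta)
  then coded_set p d s M j theta else set0.
apply: (@bowen_H_bigcup_eq0 _ _ _ _ Z) => [x /EF|i].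
  move=> [F [mu [FF ooF muT empF muS]]].
  have hs := le_lt_trans muS Ss.
  have [M [j [theta h]]] := exists_code cX cT FF ooF muT empF d0 pd hs.
  by exists (pickle (M, j, theta)) => //; rewrite /Z pickleK.
rewrite /Z; case: unpickle => [[[M j] theta]|]; first exact: bowen_H_coded_set.
apply: (bowen_H_eq0_subset _ (lexx _) (@bowen_H_coded_set k p d s 0 0 [::])).
exact: sub0set.
Qed.

End UpperBound.

Lemma cvg_le_limn_esup {R : realType} (F : set_system nat) (u : nat -> R) (l a : R) :
  ProperFilter F -> \oo `<=` F -> u n @[n --> F] --> l ->
  (limn_esup (fun n => (u n)%:E) <= a%:E)%E -> l <= a.
Proof.
move=> FF ooF ul ua; apply/ler_addgt0Pr => e e0.
have : (limn_esup (fun n => (u n)%:E) < (a + e)%:E)%E.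
  by apply: le_lt_trans ua _; rewrite lte_fin ltrDl.
move=> /ereal_inf_lt[_ [A ooA <-] supA].
rewrite -(cvg_lim _ ul)//; apply: limr_le; first exact: cvgP ul.
apply: filterS (ooF _ ooA) => n An; rewrite -lee_fin (le_trans _ (ltW supA))//.
by apply: ereal_sup_ubound; exists n.
Qed.

Theorem theorem4p1 (R : realType) (X : pmetricType R) (T : X -> X)
  (B : completeNormedModType R) (r : nat)
  (Phi : {ptws 'I_r -> X} -> B -> R) (alpha : B -> R) (W : set B) :
  compact [set: X] ->
  continuous T ->
  saturated T ->
  (0 < r)%N ->
  (forall x, is_dual (Phi x)) ->
  (forall w : B, continuous (fun x : {ptws 'I_r -> X} => Phi x w)) ->
  is_dual alpha ->
  (M_Phi T Phi alpha W = set0 -> E_Phi T Phi alpha W = set0) /\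
  (M_Phi T Phi alpha W != set0 ->
     htop T (E_Phi T Phi alpha W) = ereal_sup [set mentropy T mu | mu in M_Phi T Phi alpha W]).
Proof.
move=> cX cT satT _ _ cPhi _.
(* Used along an ultrafilter for points of [E_Phi], and along [\oo] for generic points. *)
have V_cvg (mu : probability (borel X) R) (F : set_system nat) x w :
    ProperFilter F -> \oo `<=` F ->
    (forall f : X -> R, continuous f ->
       empirical (fun j => iter j T x) n f @[n --> F] --> Rintegral mu setT f) ->
    V_pair T Phi n x w @[n --> F] --> prod_integral mu r (fun z => Phi z w).
  move=> FF ooF empF.
  (* [V_pair] uses the times 1 to [n], that is the orbit of [T x], whose means differ from those of
     [x] by a vanishing term. *)
  apply: (@vmean_cvg _ _ cX mu F (fun i => iter i.+1 T x)) => // f cf.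
  have [M M0 fM] := continuous_bound cX cf.
  pose y j := iter j T x.
  have sh : empirical y n f - empirical (y \o S) n f @[n --> F] --> (0 : R).
    by move=> A /(empirical_shift_cvg y fM)/ooF.
  rewrite (_ : (fun n => _) = fun n => empirical y n f -
      (empirical y n f - empirical (y \o S) n f)); last first.
    by apply/funext => n; rewrite opprB addrC subrK.
  by rewrite -[Rintegral _ _ _]subr0; apply: cvgB; [exact: empF|exact: sh].
have E_ultra x : E_Phi T Phi alpha W x -> exists F mu,
    [/\ ProperFilter F, \oo `<=` F, M_Phi T Phi alpha W mu &
     forall f : X -> R, continuous f ->
        empirical (fun j => iter j T x) n f @[n --> F] --> Rintegral mu setT f].
  move=> Ex; have [F [FU ooF]] := @ultraFilterLemma nat \oo _.
  have [mu muT empF] := empirical_ultralimit cX cT x FU ooF.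
  have FF : ProperFilter F by exact: ultra_proper.
  exists F, mu; split => //; split => // w Ww.
  exact: cvg_le_limn_esup (V_cvg mu F x w _ ooF empF) (Ex w Ww).
split=> [M0|_].
  by apply/seteqP; split => // x /E_ultra[F [mu [_ _]]]; rewrite M0.
apply/eqP; rewrite eq_le; apply/andP; split.
  apply: htop_le_ultralimit => // x /E_ultra[F [mu [FF ooF Mmu empF]]].
  exists F, mu; split => //; first exact: Mmu.1.
  by apply: ereal_sup_ubound; exists mu.
apply: ge_ereal_sup => _ [mu [muT muW] <-].
have <- := satT mu muT; apply: htop_subset => x Gx w Ww.
have Vw := V_cvg mu \oo x w eventually_filter (@subset_refl _ _) Gx.
have [_ ->] : _ * (_ = (prod_integral mu r (fun z => Phi z w))%:E) :=
  cvg_limn_einf_sup (cvg_EFin (f := fun n => (V_pair T Phi n x w)%:E) (nearW _ (fun=> erefl)) Vw).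
by rewrite lee_fin; exact: muW.
Qed.
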